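(* Fix an integer $d\geq 2$ and consider the Ising model on $\mathbb{T}^d$. Let $J_1,J_2>0$ and $h_1\in\mathbb{R}$ be given. Define \[ f_{\pm}(J_1,J_2,h_1)=\inf\{\,h\in\mathbb{R}:\mu_h^{J_2,+}\geq \mu_{h_1}^{J_1,\pm}\,\},\qquad g_{\pm}(J_1,J_2,h_1)=\inf\{\,h\in\mathbb{R}:\mu_h^{J_2,-}\geq \mu_{h_1}^{J_1,\pm}\,\}, \] and $\tau_\pm=t_{\pm}(J_1,h_1)+|J_1-J_2|$. Then \[ f_{\pm}(J_1,J_2,h_1)=\begin{cases} -h^*(J_2) &\text{if } t_-(J_2,-h^*(J_2))\leq \tau_\pm<t^*(J_2),\\ \tau_\pm-d\,\phi_{J_2}(\tau_\pm) &\text{if } \tau_\pm\geq t^*(J_2) \text{ or } \tau_\pm<t_-(J_2,-h^*(J_2)), \end{cases} \] \[ g_{\pm}(J_1,J_2,h_1)=\begin{cases} h^*(J_2) &\text{if } -t^*(J_2)< \tau_\pm\leq t_+(J_2,h^*(J_2)),\\ \tau_\pm-d\,\phi_{J_2}(\tau_\pm) &\text{if } \tau_\pm\leq -t^*(J_2) \text{ or } \tau_\pm>t_+(J_2,h^*(J_2)). \end{cases} \] (Each of $f_\pm$ and $g_\pm$ is meant with matching sign choice $\pm$ throughout.)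
   Context: $\mathbb{T}^d$ is the infinite tree in which every vertex has exactly $d+1$ neighbours. $\{-1,1\}^V$ carries the coordinatewise partial order and product topology; $\mu_1\leq\mu_2$ means $\int f\,d\mu_1\leq\int f\,d\mu_2$ for all real-valued continuous increasing $f$. For $J>0$, $h\in\mathbb{R}$, a Gibbs measure for the Ising model on a graph $G=(V,E)$ is a probability measure $\mu$ on $\{-1,1\}^V$ such that for all finite $U\subseteq V$, $\sigma\in\{-1,1\}^U$, $\eta\in\{-1,1\}^{V\setminus U}$, $\mu(X(U)=\sigma\mid X(V\setminus U)=\eta)$ is proportional to $\exp[J(\sum_{\langle x,y\rangle\in E, x,y\in U}\sigma(x)\sigma(y)+\sum_{\langle x,y\rangle\in E,x\in U,y\notin U}\sigma(x)\eta(y))+h\sum_{x\in U}\sigma(x)]$. The plus state $\mu_h^{J,+}$ (resp. minus state $\mu_h^{J,-}$) is the Gibbs measure that dominates (resp. is dominated by) every Gibbs measure with parameters $J,h$. For $J>0$ let $\phi_J(t)=\frac12\log\frac{\cosh(t+J)}{\cosh(t-J)}$, $t\in\mathbb{R}$. The equation $t=h+d\,\phi_J(t)$ has between one and three real solutions; $t_+(J,h)$ and $t_-(J,h)$ denote its largest and smallest real solution. Let $h^*(J)=\max_{t\geq 0}(d\,\phi_J(t)-t)$ and let $t^*(J)$ be the unique $t\geq0$ at which $t\mapsto d\,\phi_J(t)-t$ attains this maximum on $[0,\infty)$. *)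

(* Defs.v *)
From HB Require Import structures.
From mathcomp Require Import all_boot all_order all_algebra finmap.
From mathcomp Require Import all_classical all_reals all_analysis.

Set Implicit Arguments.
Unset Strict Implicit.
Unset Printing Implicit Defensive.

Import Order.TTheory GRing.Theory Num.Theory.
Import numFieldNormedType.Exports.
Local Open Scope classical_set_scope.
Local Open Scope ring_scope.

(* The tree T^d : every vertex has exactly d+1 neighbours.                    *)
(* A vertex is either the root (None) or Some (a, s): go from the root to its *)
(* child number a : 'I_(d+1), then successively to the child number s_1, s_2, *)
(* ... : 'I_d (every non-root vertex has d children and one parent).          *)
Definition vertex (d : nat) : Type := option ('I_d.+1 * seq 'I_d).

Definition parent d (v : vertex d) : option (vertex d) :=
  match v with
  | None => None
  | Some (a, s) =>
      Some (if s is [::] then None else Some (a, take (size s).-1 s))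
  end.

Definition children d (v : vertex d) : seq (vertex d) :=
  match v with
  | None => [seq Some (a, [::]) | a <- enum 'I_d.+1]
  | Some (a, s) => [seq Some (a, rcons s b) | b <- enum 'I_d]
  end.

Definition nbrs d (v : vertex d) : seq (vertex d) :=
  (if parent v is Some p then [:: p] else [::]) ++ children v.

Definition adj d (x y : vertex d) : Prop := parent y = Some x \/ parent x = Some y.

(* Configuration space {-1,1}^V : spins are booleans, true = +1, false = -1.  *)
Definition spin {R : realType} (b : bool) : R := if b then 1 else -1.

Definition coord_events d : set (set (vertex d -> bool)) :=
  [set A | exists x b, A = [set w | w x = b]].

Arguments coord_events d : clear implicits.

Definition config d := g_sigma_algebraType (coord_events d).

Definition coord_events_out d (U : {fset vertex d}) : set (set (vertex d -> bool)) :=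
  [set A | exists x b, x \notin U /\ A = [set w | w x = b]].

Definition glue d (U : {fset vertex d}) (s : {ffun U -> bool}) (eta : vertex d -> bool)
  : vertex d -> bool :=
  fun x => if (insub x : option U) is Some u then s u else eta x.

(* the exponent of the Ising weight in a finite volume U (with boundary
   condition given by w outside U):
     J ( sum_{<x,y> in E, x,y in U} w x w y + sum_{<x,y> in E, x in U, y notin U} w x w y)
     + h sum_{x in U} w x
   (each inner edge is counted once, through its parent -> child orientation) *)
Definition energy {R : realType} d (J h : R) (U : {fset vertex d})
    (w : vertex d -> bool) : R :=
  J * (\sum_(x <- U) \sum_(y <- children x | y \in U) spin (w x) * spin (w y)
       + \sum_(x <- U) \sum_(y <- nbrs x | y \notin U) spin (w x) * spin (w y))
  + h * \sum_(x <- U) spin (w x).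

Definition gibbs_kernel {R : realType} d (J h : R) (U : {fset vertex d})
    (s : {ffun U -> bool}) (eta : vertex d -> bool) : R :=
  expR (energy J h U (glue s eta)) /
  \sum_(s' : {ffun U -> bool}) expR (energy J h U (glue s' eta)).

Arguments gibbs_kernel {R d} J h U s eta.

Definition is_gibbs {R : realType} d (J h : R) (mu : probability (config d) R) : Prop :=
  forall (U : {fset vertex d}) (s : {ffun U -> bool}) (A : set (config d)),
    <<s coord_events_out U >> A ->
    mu ([set w : config d | forall u : U, w (val u) = s u] `&` A) =
    (\int[mu]_(w in A) (gibbs_kernel J h U s w)%:E)%E.

Definition increasing {R : realType} d (f : (vertex d -> bool) -> R) : Prop :=
  forall w1 w2 : vertex d -> bool, (forall x, w1 x ==> w2 x) -> f w1 <= f w2.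

Definition dominated {R : realType} d (mu1 mu2 : probability (config d) R) : Prop :=
  forall f : {ptws vertex d -> bool} -> R,
    continuous f -> increasing f ->
    (\int[mu1]_w (f w)%:E <= \int[mu2]_w (f w)%:E)%E.

Definition is_plus_state {R : realType} d (J h : R) (mu : probability (config d) R) :=
  is_gibbs J h mu /\ forall nu, is_gibbs J h nu -> dominated nu mu.
Definition is_minus_state {R : realType} d (J h : R) (mu : probability (config d) R) :=
  is_gibbs J h mu /\ forall nu, is_gibbs J h nu -> dominated mu nu.

Definition dom_threshold {R : realType} d (top : R -> probability (config d) R)
    (mu : probability (config d) R) : \bar R :=
  ereal_inf [set h%:E | h in [set h | dominated mu (top h)]].

Definition cosh {R : realType} (x : R) : R := (expR x + expR (- x)) / 2.

Definition phi {R : realType} (J t : R) : R :=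
  ln (cosh (t + J) / cosh (t - J)) / 2.

Definition fp_set {R : realType} (d : nat) (J h : R) : set R :=
  [set t | t = h + d%:R * phi J t].

Definition t_plus {R : realType} (d : nat) (J h : R) : R := sup (fp_set d J h).
Definition t_minus {R : realType} (d : nat) (J h : R) : R := inf (fp_set d J h).

Definition h_star {R : realType} (d : nat) (J : R) : R :=
  sup [set d%:R * phi J t - t | t in [set t : R | 0 <= t]].

(* t^*(J) = the (unique) t >= 0 at which the maximum is attained *)
Definition t_star {R : realType} (d : nat) (J : R) : R :=
  xget 0 [set t : R | 0 <= t /\ d%:R * phi J t - t = h_star d J].

(* Main.v *)
Require Import Defs.
From HB Require Import structures.
From mathcomp Require Import all_boot all_order all_algebra finmap.
From mathcomp Require Import all_classical all_reals all_analysis.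
From mathcomp Require Import measurable_realfun.
From mathcomp Require Import ring lra zify.
Import Order.TTheory GRing.Theory Num.Theory.
Import numFieldNormedType.Exports.
Local Open Scope classical_set_scope.
Local Open Scope ring_scope.

(** If [t = h + d phi_J(t)], the Markov chain on the tree whose spins are [+1]
    with probability [e^x / (e^x + e^-x)], [x = t + J * (spin of the parent)],
    and whose root has field [t + phi_J(t)], is a Gibbs measure for [(J, h)]:
    in the product of its transition probabilities every subtree contributes
    [phi_J(t)] to the field of its root.  Inside a ball, the Gibbs kernel with an
    arbitrary boundary condition is the same kind of chain with inhomogeneous
    fields, monotone in the boundary condition; under the extreme boundary
    conditions the fields at a fixed vertex are iterates of
    [t |-> h + d phi_J(t)], which converge to [t_+] and [t_-].  Hence each Gibbs
    measure lies between the chains of [t_-] and [t_+], and these chains agree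
    with the minus and plus states on increasing continuous functions.

    The chain of [(J1, t1)] is dominated by the chain of [(J2, t2)] if and only
    if [t1 + |J1 - J2| <= t2]: sampling the vertices one after the other gives
    one direction, the probabilities that a long ray is constantly [+1] or
    constantly [-1] give the other.  So [f] and [g] are the infima of the [h]
    with [tau <= t_+(J2, h)] and [tau <= t_-(J2, h)], that is, the minimum over
    [[tau, +oo[] and the maximum over []-oo, tau]] of the odd function
    [t - d phi(t)], which is convex on nonnegative reals. *)

Set Implicit Arguments.
Unset Strict Implicit.
Unset Printing Implicit Defensive.

(** * The fixed point equation *)
Section calculus.
Context {R : realType}.
Implicit Types J t h x y : R.

Lemma cosh_gt0 x : 0 < cosh x.
Proof. by rewrite /cosh divr_gt0// addr_gt0 ?expR_gt0. Qed.

Lemma coshN x : cosh (- x) = cosh x.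
Proof. by rewrite /cosh opprK addrC. Qed.

Lemma phiE J t : phi J t = (ln (cosh (t + J)) - ln (cosh (t - J))) / 2.
Proof. by rewrite /phi ln_div ?posrE ?cosh_gt0. Qed.

Lemma phiN J t : phi J (- t) = - phi J t.
Proof.
rewrite !phiE -[in X in ln X - _]coshN -[in X in _ - ln X]coshN !opprD !opprK.
by rewrite -mulNr opprB.
Qed.

Lemma phi0 J : phi J 0 = 0.
Proof. by have := phiN J 0; rewrite oppr0 => H; lra. Qed.

Lemma is_derive_cosh c x :
  is_derive x 1 (fun t => cosh (t + c)) ((expR (x + c) - expR (- (x + c))) / 2).
Proof.
have e1 : is_derive x 1 (fun t : R => expR (t + c)) (expR (x + c) * (1 + 0)).
  exact: (@is_derive1_comp _ expR (fun t : R => t + c)).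
have e2 : is_derive x 1 (fun t : R => expR (- (t + c))) (expR (- (x + c)) * - (1 + 0)).
  exact: (@is_derive1_comp _ expR (fun t : R => - (t + c))).
have -> : (fun t => cosh (t + c)) =
    (2^-1 : R) *: ((fun t : R => expR (t + c)) + (fun t : R => expR (- (t + c)))).
  by apply/funext => t; rewrite /cosh /= mulrC.
apply: is_derive_eq.
by rewrite /GRing.scale/=; field.
Qed.

(** The derivative of [phi J], that is [sinh (2 J) / (cosh (2 t) + cosh (2 J))]. Only [cosh (2 t)]
    varies with [t], which makes it decreasing on nonnegative reals. *)
Definition dphi J t : R :=
  (expR (J + J) - expR (- (J + J))) /
  (expR (t + t) + expR (- (t + t)) + expR (J + J) + expR (- (J + J))).

Lemma is_derive_phi J x : is_derive x 1 (phi J) (dphi J x).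
Proof.
have L c : is_derive x 1 (fun t => ln (cosh (t + c)))
   ((cosh (x + c))^-1 * ((expR (x + c) - expR (- (x + c))) / 2)).
  apply: (@is_derive1_comp _ (@ln R) (fun t => cosh (t + c))).
    by apply: is_derive1_ln; exact: cosh_gt0.
  exact: is_derive_cosh.
have -> : phi J = (2^-1 : R) *: ((fun t => ln (cosh (t + J)))
    - (fun t => ln (cosh (t + - J)))).
  by apply/funext => t; rewrite phiE mulrC.
have := L J; have := L (- J) => LN LP.
apply: is_derive_eq.
rewrite /GRing.scale/= /dphi /cosh !opprD !opprK !expRD !expRN.
have := expR_gt0 x; have := expR_gt0 J.
set a := expR x; set b := expR J => b0 a0.
by field; rewrite !lt0r_neq0//; nra.
Qed.

Lemma phi_continuous J : continuous (phi J).
Proof.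
move=> x; apply: differentiable_continuous; apply/derivable1_diffP.
exact: (@ex_derive _ _ _ _ _ _ _ (is_derive_phi J x)).
Qed.

Lemma dphi_ge0 J t : 0 <= J -> 0 <= dphi J t.
Proof.
move=> J0; rewrite /dphi divr_ge0//.
by rewrite subr_ge0 ler_expR; lra.
Qed.

Lemma le_phi J : 0 <= J -> {homo phi J : x y / x <= y}.
Proof.
move=> J0 x y xy.
have [c _ E] := MVT_segment xy (fun z _ => is_derive_phi J z)
  (continuous_subspaceT (@phi_continuous J)).
by rewrite -subr_ge0 E mulr_ge0 ?subr_ge0// dphi_ge0.
Qed.

Lemma expRDN_le x y : 0 <= x <= y ->
  expR x + expR (- x) <= expR y + expR (- y).
Proof.
move=> /andP[x0 xy]; rewrite !expRN.
have : 1 <= expR x by rewrite -expR0 ler_expR.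
have : expR x <= expR y by rewrite ler_expR.
set a := expR x; set b := expR y => ab a1.
have b0 : 0 < b by lra.
have a0 : 0 < a by lra.
rewrite -subr_ge0.
have -> : b + b^-1 - (a + a^-1) = (b - a) * (a * b - 1) / (a * b).
  by field; rewrite !lt0r_neq0.
by rewrite divr_ge0 ?mulr_ge0//; nra.
Qed.

Lemma dphi_decr J x y : 0 <= J -> 0 <= x <= y -> dphi J y <= dphi J x.
Proof.
move=> J0 xy; rewrite /dphi ler_wpM2l//.
  by rewrite subr_ge0 ler_expR; lra.
have E : expR (x + x) + expR (- (x + x)) <= expR (y + y) + expR (- (y + y)).
  by apply: expRDN_le; lra.
have ? := expR_gt0 (x + x); have ? := expR_gt0 (- (x + x)).
have ? := expR_gt0 (y + y); have ? := expR_gt0 (- (y + y)).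
have ? := expR_gt0 (J + J); have ? := expR_gt0 (- (J + J)).
by rewrite lef_pV2 ?posrE; lra.
Qed.

Lemma phi_leJ J t : 0 <= J -> phi J t <= J.
Proof.
move=> J0.
have E : cosh (t + J) / cosh (t - J) <= expR (J + J).
  rewrite ler_pdivrMr ?cosh_gt0// /cosh mulrA ler_wpM2r// mulrDr -!expRD.
  by rewrite lerD// ler_expR; lra.
suff H : ln (cosh (t + J) / cosh (t - J)) <= J + J.
  by rewrite /phi ler_pdivrMr//; apply: le_trans H _; lra.
have q0 : 0 < cosh (t + J) / cosh (t - J) by rewrite divr_gt0 ?cosh_gt0.
by rewrite -[leRHS]expRK ler_ln// posrE// expR_gt0.
Qed.

Lemma phi_geNJ J t : 0 <= J -> - J <= phi J t.
Proof. by move=> J0; rewrite lerNl -phiN phi_leJ. Qed.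

End calculus.

(** * Extreme fixed points and the function [t - d phi(t)] *)

Section fixed_points.
Context {R : realType} (d : nat) (J : R).
Hypothesis J0 : 0 <= J.
Implicit Types t h x y : R.

Definition iter_field h t : R := h + d%:R * phi J t.

Lemma le_iter_field h : {homo iter_field h : x y / x <= y}.
Proof. by move=> x y xy; rewrite lerD2l ler_wpM2l// le_phi. Qed.

(** Since [phi J] is at most [J], the start [h + d J] bounds every value of [iter_field h]. It is
    also the field of a non-root vertex whose children all have spin [+1]. *)
Let u h k := iter k (iter_field h) (h + d%:R * J).

Lemma fp_set_le_iter h t k : fp_set d J h t -> t <= u h k.
Proof.
move=> ft; elim: k => [|k IH]; rewrite /u/=.
  by rewrite [leLHS]ft lerD2l ler_wpM2l// phi_leJ.
by rewrite [leLHS]ft; exact: le_iter_field.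
Qed.

Let u_decr h k : u h k.+1 <= u h k.
Proof.
elim: k => [|k IH]; rewrite /u/=; first by rewrite lerD2l ler_wpM2l// phi_leJ.
exact: le_iter_field.
Qed.

Let u_lb h k : h - d%:R * J <= u h k.
Proof.
case: k => [|k]; rewrite /u/=.
  by rewrite lerD2l -mulrN ler_wpM2l// ge0_cp// ?oppr_le0.
by rewrite lerD2l -mulrN ler_wpM2l// phi_geNJ.
Qed.

(** The iterates decrease, are bounded below and stay above every fixed point. By continuity their
    limit is a fixed point, hence the largest one. *)
Lemma iter_field_cvg h :
  fp_set d J h (t_plus d J h) /\ u h k @[k --> \oo] --> t_plus d J h.
Proof.
have nu : {homo u h : n m / (n <= m)%N >-> m <= n}.
  by apply/nonincreasing_seqP => k; exact: u_decr.
have cu : cvgn (u h).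
  apply: nonincreasing_is_cvgn => //.
  by exists (h - d%:R * J) => _ [k _ <-]; exact: u_lb.
set L := limn (u h).
have cL : u h k @[k --> \oo] --> L by [].
have fL : fp_set d J h L.
  have c1 : u h k.+1 @[k --> \oo] --> L by rewrite -(cvg_shiftS (u h)) in cL.
  have c2 : u h k.+1 @[k --> \oo] --> h + d%:R * phi J L.
    apply: cvgD; first exact: cvg_cst.
    apply: cvgM; first exact: cvg_cst.
    by apply: continuous_cvg => //; exact: phi_continuous.
  exact: (cvg_unique _ c1 c2).
have sL : ubound (fp_set d J h) L.
  move=> t ft; apply: limr_ge => //; near=> k; exact: fp_set_le_iter.
suff -> : t_plus d J h = L by [].
apply/eqP; rewrite eq_le; apply/andP; split.
  by apply: ge_sup => //; exists L.
by apply: ub_le_sup => //; exists L.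
Unshelve. all: by end_near. Qed.

Lemma fp_set_t_plus h : fp_set d J h (t_plus d J h).
Proof. by have [] := iter_field_cvg h. Qed.

Lemma le_t_plus h t : fp_set d J h t -> t <= t_plus d J h.
Proof.
by move=> ft; apply: ub_le_sup => //; exists (u h 0) => s fs; exact: fp_set_le_iter.
Qed.

Lemma fp_setN h t : fp_set d J (- h) (- t) <-> fp_set d J h t.
Proof. by rewrite /fp_set/= phiN mulrN -opprD; split=> [/oppr_inj|{1}->]. Qed.

(** As [phi J] is odd, changing the signs of [t] and [h] exchanges the largest and the smallest
    solution. All facts on [t_minus] are obtained in this way. *)
Lemma t_minusN h : t_minus d J h = - t_plus d J (- h).
Proof.
rewrite /t_minus /t_plus /inf; congr (- sup _).
apply/seteqP; split=> [_ [t ft <-]|t ft]/=; first exact/fp_setN.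
by exists (- t); rewrite ?opprK//; apply/fp_setN; rewrite opprK.
Qed.

Lemma fp_set_t_minus h : fp_set d J h (t_minus d J h).
Proof. by apply/fp_setN; rewrite t_minusN opprK; exact: fp_set_t_plus. Qed.

Lemma ge_t_minus h t : fp_set d J h t -> t_minus d J h <= t.
Proof. by move=> ft; rewrite t_minusN lerNl; apply/le_t_plus/fp_setN. Qed.

(** The only external field for which [t] solves the fixed point equation. *)
Definition bal t : R := t - d%:R * phi J t.

Lemma fp_setE h t : fp_set d J h t <-> bal t = h.
Proof. by rewrite /fp_set/= /bal; split=> [{1}->|<-]; rewrite ?addrK ?subrK. Qed.

Lemma balN t : bal (- t) = - bal t.
Proof. by rewrite /bal phiN mulrN opprK opprB addrC. Qed.

Lemma bal0 : bal 0 = 0. Proof. by rewrite /bal phi0 mulr0 subr0. Qed.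

Lemma is_derive_bal x : is_derive x 1 bal (1 - d%:R * dphi J x).
Proof.
have := is_derive_phi J x => D.
have -> : bal = id - d%:R *: phi J by apply/funext => t; rewrite /bal.
exact: is_derive_eq.
Qed.

Lemma bal_continuous : continuous bal.
Proof.
move=> x; apply: differentiable_continuous; apply/derivable1_diffP.
exact: (@ex_derive _ _ _ _ _ _ _ (is_derive_bal x)).
Qed.

(* This is what is used of the convexity of [bal] on nonnegative reals. *)
Lemma bal_three_points x y z : 0 <= x -> x < y -> y < z ->
  bal x <= bal y -> bal y <= bal z.
Proof.
move=> x0 xy yz bxy.
have C a b := continuous_subspaceT (A := `[a, b]) bal_continuous.
have [p /[!in_itv]/=/andP[xp py] Ep] := MVT xy (fun w _ => is_derive_bal w) (C _ _).
have [q /[!in_itv]/=/andP[yq qz] Eq] := MVT yz (fun w _ => is_derive_bal w) (C _ _).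
have dpq : dphi J q <= dphi J p by apply: dphi_decr => //; lra.
have p0 : 0 <= 1 - d%:R * dphi J p.
  have yx : 0 < y - x by rewrite subr_gt0.
  by rewrite -(pmulr_lge0 _ yx) -Ep subr_ge0.
have d0 : 0 <= d%:R :> R by [].
have := ler_wpM2l d0 dpq => dd.
by rewrite -subr_ge0 Eq mulr_ge0; lra.
Qed.

Lemma bal_ge t : t - d%:R * J <= bal t.
Proof. by rewrite lerD2l lerN2 ler_wpM2l// phi_leJ. Qed.

Lemma bal_ivt_ge t h : bal t <= h -> exists2 s, t <= s & bal s = h.
Proof.
move=> th.
(* From [h + d J] on, [bal_ge] keeps [bal] above [h], so the intermediate value theorem applies on
   [[t, b]]. *)
set b := Num.max t (h + d%:R * J).
have tb : t <= b by rewrite le_max lexx.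
have hb : h <= bal b.
  by apply: le_trans (bal_ge b); rewrite lerBrDr le_max lexx orbT.
have H : Num.min (bal t) (bal b) <= h <= Num.max (bal t) (bal b).
  by rewrite ge_min th le_max hb orbT.
have [s /[!in_itv]/=/andP[ts _] E] := IVT tb (continuous_subspaceT bal_continuous) H.
by exists s.
Qed.

Lemma bal_ivt_le t h : h <= bal t -> exists2 s, s <= t & bal s = h.
Proof.
rewrite -lerN2 -balN => /bal_ivt_ge[s st E].
by exists (- s); rewrite ?balN ?E ?opprK// lerNl.
Qed.

(** This turns a condition on the largest solution into membership of [h] in the image of [[tau,
    +oo[] under [bal]. The next lemma does the same for [t_minus], with the complement of the image
    of []-oo, tau[]. *)
Lemma t_plus_geP h tau : tau <= t_plus d J h <-> exists2 t, tau <= t & bal t = h.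
Proof.
split=> [H|[t tt bt]].
  by exists (t_plus d J h) => //; apply/fp_setE; exact: fp_set_t_plus.
by apply: le_trans tt _; apply/le_t_plus/fp_setE.
Qed.

Lemma t_minus_geP h tau : tau <= t_minus d J h <-> forall t, t < tau -> bal t <> h.
Proof.
split=> [H t tt /fp_setE/ge_t_minus|H]; first by move=> ?; lra.
rewrite leNgt; apply/negP => /H; apply.
by apply/fp_setE; exact: fp_set_t_minus.
Qed.

Lemma h_star_t_star : [/\ 0 <= t_star d J, bal (t_star d J) = - h_star d J &
  forall t, 0 <= t -> - h_star d J <= bal t].
Proof.
(* A minimum over [[0, d J + 1]] is one over all nonnegative reals: beyond [d J + 1], [bal_ge] puts
   [bal] above [bal 0 = 0]. *)
have [c /[!in_itv]/=/andP[c0 _] mc] := EVT_min (ler_wpDr ler01 (mulr_ge0 (ler0n _ d) J0))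
  (continuous_subspaceT bal_continuous).
have minc t : 0 <= t -> bal c <= bal t.
  move=> t0; have [tb|tb] := leP t (d%:R * J + 1).
    by apply: mc; rewrite in_itv/= t0 tb.
  apply: le_trans (_ : bal 0 <= _).
    by apply: mc; rewrite in_itv/= lexx; have := mulr_ge0 (ler0n R d) J0; lra.
  by rewrite bal0; apply: le_trans (bal_ge t); lra.
have hs : h_star d J = - bal c.
  apply/eqP; rewrite eq_le; apply/andP; split.
    apply: ge_sup; first by exists (d%:R * phi J 0 - 0); exists 0 => //=.
    by move=> _ [t/= t0 <-]; rewrite -opprB lerN2; exact: minc.
  apply: ub_le_sup.
    by exists (- bal c) => _ [t/= t0 <-]; rewrite -opprB lerN2; exact: minc.
  by exists c => //; rewrite -opprB.
have : [set t : R | 0 <= t /\ d%:R * phi J t - t = h_star d J] (t_star d J).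
  by apply: (@xgetPex _ 0); exists c; split=> //; rewrite hs -opprB.
move=> [t0 E]; split=> // [|t t0']; first by rewrite -E opprB.
by rewrite hs opprK minc.
Qed.

End fixed_points.

(** * Minima of [bal] on half-lines and the resulting infima *)

Section thresholds.
Context {R : realType} (d : nat) (J : R).
Hypothesis J0 : 0 <= J.
Implicit Types t h x y M : R.

Definition bal_min tau M := (exists2 t, tau <= t & bal d J t = M) /\
  forall t, tau <= t -> M <= bal d J t.

Let h_star_ge0 : 0 <= h_star d J.
Proof.
by have [_ _ /(_ 0 (lexx 0))] := h_star_t_star d J0; rewrite bal0 oppr_le0.
Qed.

Let bal_t_plus : bal d J (t_plus d J (h_star d J)) = h_star d J.
Proof. exact/fp_setE/fp_set_t_plus. Qed.

Let t_plus_ge0 : 0 <= t_plus d J (h_star d J).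
Proof.
by apply/(t_plus_geP _ J0)/bal_ivt_ge => //; rewrite bal0.
Qed.

(** A value above [h_star] at [s] exceeds [bal 0 = 0], so convexity would keep [bal] at least as
    large up to the endpoint, where it equals [h_star]. *)
Let bal_le_h_star s : 0 <= s <= t_plus d J (h_star d J) -> bal d J s <= h_star d J.
Proof.
move=> /andP[s0 ss]; rewrite leNgt; apply/negP => H.
have s1 : 0 < s.
  rewrite lt_neqAle s0 andbT; apply/eqP => e.
  by move: H; rewrite -e bal0 ltNge h_star_ge0.
have s2 : s < t_plus d J (h_star d J).
  rewrite lt_neqAle ss andbT; apply/eqP => e.
  by move: H; rewrite e bal_t_plus ltxx.
have := bal_three_points (d := d) J0 (lexx 0) s1 s2.
rewrite bal0 bal_t_plus => /(_ (le_trans h_star_ge0 (ltW H))) ?; lra.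
Qed.

(** Here [bal 0 <= bal s], so convexity at [0 < s < s'] gives the claim. In the degenerate case
    [s = 0], [h_star] vanishes and [0] is already a minimum over the nonnegative reals. *)
Let bal_nd s s' : t_plus d J (h_star d J) <= s <= s' -> bal d J s <= bal d J s'.
Proof.
move=> /andP[ss]; rewrite le_eqVlt => /predU1P[->//|s's].
have s_ge0 := le_trans t_plus_ge0 ss.
have : bal d J 0 <= bal d J s.
  rewrite bal0; move: ss; rewrite le_eqVlt => /predU1P[<-|ss].
    by rewrite bal_t_plus.
  move: t_plus_ge0; rewrite le_eqVlt => /predU1P[e|p0].
    have [_ _ /(_ s s_ge0)] := h_star_t_star d J0.
    by rewrite -{1}bal_t_plus -e bal0 oppr0.
  have := bal_three_points (d := d) J0 (lexx 0) p0 ss.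
  rewrite bal0 bal_t_plus => /(_ h_star_ge0); exact: le_trans.
move: s_ge0; rewrite le_eqVlt => /predU1P[e _|p0].
  have t0 : t_plus d J (h_star d J) = 0.
    by apply/eqP; rewrite eq_le t_plus_ge0 andbT e.
  have [_ _ /(_ s')] := h_star_t_star d J0.
  by rewrite -{1}bal_t_plus t0 -e bal0 oppr0; apply; lra.
exact: bal_three_points.
Qed.

(** Right of [t_minus d J (- h_star d J)], [bal] is at least [- h_star], with equality at [t_star];
    right of [t_star] it is nondecreasing. Left of [t_minus d J (- h_star d J)] it is, by oddness,
    nondecreasing and at most [- h_star]. In the last two regions the minimum is therefore at
    [tau]. *)
Lemma bal_minP tau :
  (t_minus d J (- h_star d J) <= tau < t_star d J -> bal_min tau (- h_star d J)) /\
  (t_star d J <= tau \/ tau < t_minus d J (- h_star d J) ->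
   bal_min tau (bal d J tau)).
Proof.
have [ts0 bts hmin] := h_star_t_star d J0.
have low t : t_minus d J (- h_star d J) <= t -> - h_star d J <= bal d J t.
  rewrite t_minusN opprK lerNl => tt.
  have [t0|t0] := leP 0 t; first exact: hmin.
  by rewrite -[t]opprK balN lerN2 bal_le_h_star// tt oppr_ge0 ltW.
split=> [/andP[tm tt]|].
  split; first by exists (t_star d J) => //; exact: ltW.
  by move=> t tt'; apply: low; exact: le_trans tt'.
move=> tt; split; first by exists tau.
move=> t taut; case: tt => [tt|].
  move: taut; rewrite le_eqVlt => /predU1P[->//|taut].
  move: tt; rewrite le_eqVlt => /predU1P[e|tt]; first by rewrite -e bts; apply: hmin; lra.
  by apply: (bal_three_points J0 ts0 tt taut); rewrite bts; apply/hmin/(le_trans ts0)/ltW.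
rewrite t_minusN opprK ltrNr => tt.
have [t1|t1] := leP (t_plus d J (h_star d J)) (- t).
  rewrite -[tau]opprK -[t]opprK (balN _ _ (- tau)) (balN _ _ (- t)) lerN2 bal_nd//.
  by rewrite t1 lerN2.
apply: le_trans (low t _); last by rewrite t_minusN opprK; lra.
by rewrite -[tau]opprK balN lerN2 -{1}bal_t_plus bal_nd// lexx ltW.
Qed.

Lemma ereal_inf_t_plus tau M (A : set R) : bal_min tau M ->
  (forall h, A h <-> tau <= t_plus d J h) ->
  ereal_inf [set h%:E | h in A] = M%:E.
Proof.
move=> [[t taut bt] minM] AE; apply/eqP; rewrite eq_le; apply/andP; split.
  apply: ereal_inf_lbound; exists M => //; apply/AE/(t_plus_geP _ J0).
  by exists t.
apply: le_ereal_inf_tmp => _ [h /AE/(t_plus_geP _ J0)[s ts <-] <-].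
by rewrite lee_fin minM.
Qed.

(** By oddness [M] is the maximum of [bal] on []-oo, tau]]. Every [h] above [M] is in [A], while [M]
    may fail to be. An [h] below [M] is a value of [bal] left of the point where [M] is attained, so
    it is not in [A]. *)
Lemma ereal_inf_t_minus tau M (A : set R) : bal_min (- tau) (- M) ->
  (forall h, A h <-> tau <= t_minus d J h) ->
  ereal_inf [set h%:E | h in A] = M%:E.
Proof.
move=> [[t taut bt] minM] AE; apply/eqP; rewrite eq_le; apply/andP; split.
  apply/lee_addgt0Pr => e e0; rewrite -EFinD.
  apply: ereal_inf_lbound; exists (M + e) => //; apply/AE/(t_minus_geP _ J0) => s st Es.
  by have := minM (- s); rewrite balN Es lerN2; lra.
apply: le_ereal_inf_tmp => _ [h /AE/(t_minus_geP _ J0) H <-].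
rewrite lee_fin leNgt; apply/negP => hM.
have : h <= bal d J (- t) by rewrite balN bt opprK ltW.
move=> /(bal_ivt_le J0)[s st bs].
have ss : s <= tau by lra.
move: ss; rewrite le_eqVlt => /predU1P[e|/H//].
have et : s = - t by lra.
by move: bs; rewrite et balN bt opprK; lra.
Qed.

End thresholds.

(** * Sequential sampling of configurations *)
Section sampling.
Context {R : realType} (d : nat).
Local Notation V := (vertex d).
Local Notation conf := (V -> bool).
Implicit Types (w : conf) (v : V) (l : seq V) (f g : conf -> R).

Definition upd w v (b : bool) : conf := fun x => if x == v then b else w x.

Lemma upd_same w v b : upd w v b v = b.
Proof. by rewrite /upd eqxx. Qed.

Lemma upd_neq w v b x : x != v -> upd w v b x = w x.
Proof. by rewrite /upd => /negbTE ->. Qed.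

Definition wle w1 w2 := forall x, w1 x ==> w2 x.

Lemma upd_wle w1 w2 v b1 b2 : wle w1 w2 -> (b1 ==> b2) ->
  wle (upd w1 v b1) (upd w2 v b2).
Proof. by move=> ww bb x; rewrite /upd; case: ifP => _. Qed.

Definition sum1 v f : conf -> R := fun w => f (upd w v true) + f (upd w v false).
(** For duplicate-free [l], this sums [f] over the configurations that agree with the given one off
    [l]. *)
Definition sumo l f := foldr sum1 f l.

(* [p v w] is the probability that the spin at [v] is [+1] given the spins [w]
   already sampled. *)
Definition step (p : V -> conf -> R) v f : conf -> R :=
  fun w => p v w * f (upd w v true) + (1 - p v w) * f (upd w v false).
(** The expectation of [f] once the vertices of [l] have been resampled, the head of [l] first. *)
Definition expect p l f := foldr (step p) f l.

Lemma expect_cat p l1 l2 f : expect p (l1 ++ l2) f = expect p l1 (expect p l2 f).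
Proof. exact: foldr_cat. Qed.

Definition kernel_bounds (p : V -> conf -> R) := forall v w, 0 <= p v w <= 1.
Definition kernel_mono (p : V -> conf -> R) :=
  forall v w1 w2, wle w1 w2 -> p v w1 <= p v w2.

(** A monotone coupling, written as an inequality between expectations. Monotonicity of [q] extends
    the comparison at one configuration to ordered pairs, and the order survives each sampling
    step. *)
Lemma le_expect p q l f g : kernel_bounds p -> kernel_bounds q ->
  kernel_mono q -> (forall v w, v \in l -> p v w <= q v w) ->
  increasing g -> (forall w, f w <= g w) ->
  forall w1 w2, wle w1 w2 -> expect p l f w1 <= expect q l g w2.
Proof.
move=> bp bq mq; elim: l => [|v l IH] pq ig fg w1 w2 ww /=.
  by apply: le_trans (fg _) _; exact: ig.
have pq1 : p v w1 <= q v w2.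
  by apply: le_trans (pq _ _ (mem_head _ _)) _; exact: mq.
have {}IH := IH (fun x w xl => pq x w (mem_behead (s := v :: l) xl)) ig fg.
have H1 := IH _ _ (upd_wle v ww (implybb true)).
have H0 := IH _ _ (upd_wle v ww (implybb false)).
have H10 := IH _ _ (upd_wle v ww (b1 := false) (b2 := true) isT).
have /andP[a0 a1] := bp v w1; have /andP[b0 b1] := bq v w2.
rewrite /step.
move: (expect p l f (upd w1 v true)) (expect p l f (upd w1 v false))
  (expect q l g (upd w2 v true)) (expect q l g (upd w2 v false)) H1 H0 H10.
move=> x1 x0 y1 y0 H1 H0 H10.
(* The unit mass is cut into [p], [q - p] and [1 - q]. Both spins are [+1] on the first piece and
   [-1] on the last; on the middle one only the upper spin is [+1]. *)
have -> : q v w2 * y1 + (1 - q v w2) * y0 =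
  p v w1 * y1 + (q v w2 - p v w1) * y1 + (1 - q v w2) * y0 by ring.
have -> : p v w1 * x1 + (1 - p v w1) * x0 =
  p v w1 * x1 + (q v w2 - p v w1) * x0 + (1 - q v w2) * x0 by ring.
by rewrite !lerD// ler_wpM2l//; lra.
Qed.

Definition local_on (D : pred V) (T : Type) (f : conf -> T) :=
  forall w1 w2, (forall x, D x -> w1 x = w2 x) -> f w1 = f w2.

(** The probabilities of the two spins at a vertex sum to one, so sampling vertices that [f] ignores
    has no effect. *)
Lemma expect_id p l (D : pred V) f : local_on D f -> {in l, forall v, ~~ D v} ->
  expect p l f = f.
Proof.
move=> lf; elim: l => [//|v l IH] nl /=.
rewrite IH => [|x xl]; last by apply: nl; rewrite inE xl orbT.
apply/funext => w; rewrite /step.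
have E b : f (upd w v b) = f w.
  apply: lf => x Dx; rewrite upd_neq//; apply: contraL Dx => /eqP ->.
  by apply: nl; exact: mem_head.
by rewrite !E; ring.
Qed.

Lemma expect_cst p l c w : expect p l (fun=> c) w = c.
Proof. by elim: l w => [//|v l IH] w /=; rewrite /step !IH; ring. Qed.

Lemma expect_sum (I : Type) (r : seq I) p l (F : I -> conf -> R) (c : I -> R) w :
  expect p l (fun w' => \sum_(i <- r) c i * F i w') w =
  \sum_(i <- r) c i * expect p l (F i) w.
Proof.
elim: l w => [//|v l IH] w /=; rewrite /step !IH !mulr_sumr -big_split/=.
by apply: eq_bigr => i _; ring.
Qed.

Lemma cvg_expect (p : nat -> V -> conf -> R) q l f w :
  (forall v w', p n v w' @[n --> \oo] --> q v w') ->
  expect (p n) l f w @[n --> \oo] --> expect q l f w.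
Proof.
move=> pq; elim: l w => [|v l IH] w /=; first exact: cvg_cst.
apply: cvgD; apply: cvgM; [exact: pq|exact: IH| |exact: IH].
by apply: cvgB; [exact: cvg_cst|exact: pq].
Qed.

(** Each transition probability may look at [D] and at the vertices sampled before; the induction
    moves the vertex just sampled into [D]. *)
Lemma expect_local p l (D : pred V) f :
  (forall l1 v l2, l = l1 ++ v :: l2 -> local_on [pred x | D x || (x \in l1)] (p v)) ->
  local_on [pred x | D x || (x \in l)] f -> local_on D (expect p l f).
Proof.
elim: l D => [|v l IH] D pD lf w1 w2 ww /=.
  by apply: lf => x /=; rewrite in_nil orbF; exact: ww.
rewrite /step (pD [::] v l erefl w1 w2) => [|x]; last first.
  by rewrite /= in_nil orbF; exact: ww.
have E b : expect p l f (upd w1 v b) = expect p l f (upd w2 v b).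
  apply: (IH [pred x | D x || (x == v)]) => [l1 x l2 el||x].
  - move=> y1 y2 yy; apply: (pD (v :: l1) x l2); first by rewrite el.
    by move=> z /= Dz; apply: yy => /=; rewrite -orbA -in_cons.
  - move=> y1 y2 yy; apply: lf => z /= Dz.
    by apply: yy => /=; rewrite -orbA -in_cons.
  - rewrite /upd/=; case: ifP => [//|_]; rewrite orbF; exact: ww.
by rewrite !E.
Qed.

End sampling.

(** * The tree *)
Section tree.
Context (d : nat).
Local Notation V := (vertex d).
Implicit Types (v x y p : V) (l : seq V).

(** The path is read from the vertex up to the root, so that passing to a child prepends a
    number. *)
Definition path_code v : seq nat :=
  if v is Some (a, s) then rcons [seq val b | b <- rev s] (val a) else [::].

(* A child gets a larger index than its parent because [CodeSeq.code (n :: s)]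
   is [2 ^ n * (2 * CodeSeq.code s + 1)] *)
Definition idx v : nat := CodeSeq.code (path_code v).

Lemma path_code_inj : injective path_code.
Proof.
move=> [[a s]|] [[b t]|] //=; last 2 first.
- by move/(congr1 size); rewrite size_rcons.
- by move/(congr1 size); rewrite size_rcons.
move/rcons_inj => [/(inj_map val_inj)/(can_inj revK) -> /val_inj -> //].
Qed.

Lemma idx_inj : injective idx.
Proof. exact: inj_comp (can_inj CodeSeq.codeK) path_code_inj. Qed.

Lemma mem_children x y : (y \in children x) = (parent y == Some x).
Proof.
case: x y => [[a s]|] [[b t]|] //=.
- apply/mapP/eqP => [[c _ [-> ->]]|].
    by case: s => [|e s]//=; rewrite size_rcons/= -cats1 take_size_cat.
  case/lastP: t => [//|t e].
  rewrite size_rcons/= -cats1 take_size_cat//.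
  have -> : (if t ++ [:: e] is [::] then None else Some (b, t)) = Some (b, t).
    by case: t.
  by move=> [-> ->]; exists e; rewrite ?mem_enum// cats1.
- by apply/mapP => -[].
- apply/mapP/eqP => [[c _ [_ ->]]//|].
  by case: t => [_|//]; exists b => //; rewrite mem_enum.
- by apply/mapP => -[].
Qed.

Lemma uniq_children x : uniq (children x).
Proof.
case: x => [[a s]|] /=; rewrite map_inj_uniq ?enum_uniq// => b c [] //.
by move/rcons_inj => [].
Qed.

Lemma size_children x : size (children x) = (d + (x == None))%N.
Proof.
case: x => [[a s]|] /=; rewrite size_map size_enum_ord ?addn0//.
by rewrite addn1.
Qed.

Lemma path_code_parent v p : parent v = Some p ->
  exists2 n, (n <= d)%N & path_code v = n :: path_code p.
Proof.
case: v => [[a s]|]//= [<-]; case/lastP: s => [|s b].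
  by exists (val a) => //; rewrite -ltnS; exact: (ltn_ord a).
have -> : take (size (rcons s b)).-1 (rcons s b) = s.
  by rewrite size_rcons/= -cats1 take_size_cat.
have -> : (if rcons s b is [::] then None else Some (a, s)) = Some (a, s).
  by case: s.
exists (val b); first exact/ltnW/(ltn_ord b).
by rewrite rev_rcons.
Qed.

Lemma idx_parent v p : parent v = Some p -> (idx p < idx v)%N.
Proof.
move=> /path_code_parent[n _]; rewrite /idx => -> /=.
set c := CodeSeq.code _; apply: (@leq_trans c.*2.+1); last by rewrite leq_pmull ?expn_gt0.
by rewrite -muln2; lia.
Qed.

Definition depth v : nat := if v is Some (a, s) then (size s).+1 else 0.

Lemma depth_parent v p : parent v = Some p -> depth v = (depth p).+1.
Proof.
case: v => [[a s]|]//= [<-]; case: s => [//|b s] /=.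
by rewrite size_takel.
Qed.

Lemma depth_children x y : y \in children x -> depth y = (depth x).+1.
Proof. by rewrite mem_children => /eqP/depth_parent. Qed.

Lemma depth_eq0 v : (depth v == 0)%N = (v == None).
Proof. by case: v => [[a s]|]. Qed.

Lemma parent_some v : v != None -> exists p, parent v = Some p.
Proof. by case: v => [[a s]|]// _; eexists. Qed.

Lemma idx_bound n : exists N, forall v, (depth v <= n)%N -> (idx v < N)%N.
Proof.
elim: n => [|n [N IH]].
  by exists 1%N => v; rewrite leqn0 depth_eq0 => /eqP ->.
(* The first entry of the path code is at most [d], the value [d] occurring only below the root, and
   the code of the parent is less than [N]. *)
exists (2 ^ d * N.*2.+1).+1 => v vn.
case: (eqVneq v None) => [->//|/parent_some[p vp]].
have pN : (idx p < N)%N by apply: IH; rewrite (depth_parent vp) in vn.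
have [m md E] := path_code_parent vp.
rewrite ltnS /idx E/= leq_mul// ?leq_pexp2l//.
by move: pN; rewrite /idx -!muln2; lia.
Qed.

Definition vertex_at (n : nat) : option V :=
  if pselect (exists v, idx v = n) is left e then Some (projT1 (cid e)) else None.

Lemma vertex_atP n v : vertex_at n = Some v <-> idx v = n.
Proof.
rewrite /vertex_at; case: pselect => [e|ne].
  case: (cid e) => x/= xn; split=> [[<-]//|vn].
  by congr Some; apply: idx_inj; rewrite xn vn.
by split=> // vn; case: ne; exists v.
Qed.

(** Initial segments of one enumeration of the tree in which parents come first; they serve both as
    finite volumes and as sampling orders. *)
Definition seg N : seq V := pmap vertex_at (iota 0 N).

Lemma mem_seg N v : (v \in seg N) = (idx v < N)%N.
Proof.
rewrite /seg mem_pmap; apply/mapP/idP => [[n nN /esym/vertex_atP ->]|vN].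
  by move: nN; rewrite mem_iota.
by exists (idx v); rewrite ?mem_iota//; apply/esym/vertex_atP.
Qed.

Lemma seg_add N M : exists2 l, seg (N + M) = seg N ++ l &
  {in l, forall v, N <= idx v}%N.
Proof.
rewrite /seg iotaD pmap_cat; eexists; first reflexivity.
move=> v; rewrite mem_pmap => /mapP[n nN /esym/vertex_atP ->].
by move: nN; rewrite mem_iota => /andP[].
Qed.

Definition idx_sorted l := pairwise (fun x y => idx x < idx y)%N l.

Lemma idx_sorted_seg N : idx_sorted (seg N).
Proof.
elim: N => [//|N IH]; rewrite /idx_sorted /seg -addn1 iotaD pmap_cat pairwise_cat.
rewrite -/(seg N) -/(idx_sorted (seg N)) IH/= add0n.
case E: (vertex_at N) => [v|]/=; rewrite ?allrel0r//.
rewrite !andbT; apply/allrelP => x y; rewrite mem_seg inE => xN /eqP ->.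
by move/vertex_atP: E => ->.
Qed.

Lemma idx_sorted_uniq l : idx_sorted l -> uniq l.
Proof. by apply: pairwise_uniq => x; rewrite ltnn. Qed.

Definition parent_closed l := forall v p, v \in l -> parent v = Some p -> p \in l.

Lemma parent_closed_seg N : parent_closed (seg N).
Proof.
by move=> v p; rewrite !mem_seg => vN /idx_parent vp; exact: ltn_trans vN.
Qed.

Lemma parent_before l l1 v l2 p : idx_sorted l -> parent_closed l ->
  l = l1 ++ v :: l2 -> parent v = Some p -> p \in l1.
Proof.
move=> sl cl el vp.
have : p \in l by apply: cl vp; rewrite el mem_cat mem_head orbT.
have pv := idx_parent vp.
rewrite el mem_cat => /orP[//|]; rewrite inE => /orP[/eqP e|pl2].
  by move: pv; rewrite e ltnn.
move: sl; rewrite /idx_sorted el pairwise_cat => /and3P[_ _ /= /andP[/allP H _]].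
by have := H _ pl2; rewrite ltnNge (ltnW pv).
Qed.

(** This is the whole ball of radius [n] once [N] exceeds the index of each vertex of depth at most
    [n]. *)
Definition ball n N := [seq v <- seg N | (depth v <= n)%N].

Lemma idx_sorted_ball n N : idx_sorted (ball n N).
Proof. by apply: pairwise_filter; exact: idx_sorted_seg. Qed.

End tree.

(** * Finite sums over spins and product weights *)

Section weights.
Context {R : realType} (d : nat).
Local Notation V := (vertex d).
Local Notation conf := (V -> bool).
Implicit Types (w : conf) (v : V) (l : seq V) (f g : conf -> R) (U : {fset V}).

Lemma sumo_mull l f g w : local_on [pred x | x \notin l] g ->
  g w * sumo l f w = sumo l (fun w' => g w' * f w') w.
Proof.
elim: l w => [//|v l IH] w lg /=; rewrite /sum1 mulrDr.
have E b : g w = g (upd w v b).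
  by apply: lg => x /=; rewrite inE negb_or => /andP[xv _]; rewrite upd_neq.
have {}IH w' : g w' * sumo l f w' = sumo l (fun w' => g w' * f w') w'.
  apply: IH => w1 w2 ww; apply: lg => x /=.
  by rewrite inE negb_or => /andP[_]; exact: ww.
by rewrite {1}(E true) (E false) !IH.
Qed.

Lemma sumo_sum (I : Type) (r : seq I) l (F : I -> conf -> R) w :
  sumo l (fun w' => \sum_(i <- r) F i w') w = \sum_(i <- r) sumo l (F i) w.
Proof. by elim: l w => [//|v l IH] w /=; rewrite /sum1 !IH -big_split. Qed.

Lemma eq_sumo l f g w : f =1 g -> sumo l f w = sumo l g w.
Proof. by move=> /funext ->. Qed.

Lemma sumo_pin l (sg : conf) g w : uniq l ->
  sumo l (fun w' => (all (fun x => w' x == sg x) l)%:R * g w') w =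
  g (fun x => if x \in l then sg x else w x).
Proof.
elim: l w g => [|v l IH] w g /=; first by rewrite mul1r.
move=> /andP[vl ul]; rewrite /sum1.
have E w' : sumo l (fun w'' =>
      ((w'' v == sg v) && all (fun x => w'' x == sg x) l)%:R * g w'') w' =
    (w' v == sg v)%:R * g (fun x => if x \in l then sg x else w' x).
  under eq_sumo do rewrite -mulnb natrM mulrAC mulrC.
  by rewrite IH//= (negbTE vl).
rewrite !E !upd_same.
have -> : (fun x => if x \in v :: l then sg x else w x) =
    (fun x => if x \in l then sg x else upd w v (sg v) x).
  apply/funext => x; rewrite inE /upd; case: eqVneq => [->|//] /=.
  by rewrite (negbTE vl).
by case: (sg v); rewrite /= mul1r mul0r ?addr0 ?add0r.
Qed.

Lemma glueE U (s : {ffun U -> bool}) w (x : V) (xU : x \in U) :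
  Defs.glue s w x = s (FSetSub xU).
Proof. by rewrite /Defs.glue insubT. Qed.

Lemma glue_out U (s : {ffun U -> bool}) w (x : V) : x \notin U -> Defs.glue s w x = w x.
Proof. by move=> xU; rewrite /Defs.glue insubN. Qed.

Definition agree U (s : {ffun U -> bool}) w := [forall u : U, w (val u) == s u].

Lemma sum_agree U (F : {ffun U -> bool} -> R) w :
  \sum_s (agree s w)%:R * F s = F [ffun u : U => w (val u)].
Proof.
rewrite (bigD1 [ffun u : U => w (val u)])//= big1 ?addr0.
  suff -> : agree [ffun u : U => w (val u)] w by rewrite mul1r.
  by apply/forallP => u; rewrite ffunE.
move=> s ns; suff /negbTE -> : ~~ agree s w by rewrite mul0r.
apply: contraNN ns => /forallP H; apply/eqP/ffunP => u.
by rewrite ffunE; apply/esym/eqP; exact: H.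
Qed.

Lemma sum_agree1 U w : \sum_(s : {ffun U -> bool}) (agree s w)%:R = 1 :> R.
Proof.
by have := sum_agree (fun _ : {ffun U -> bool} => 1) w; under eq_bigr do rewrite mulr1.
Qed.

Lemma agree_all U l (s : {ffun U -> bool}) w w' : l =i U ->
  agree s w = all (fun x => w x == Defs.glue s w' x) l.
Proof.
move=> lU; apply/forallP/allP => [H x xl|H [x xU]] /=.
  have xU : x \in U by rewrite -lU.
  by rewrite glueE; exact: (H (FSetSub xU)).
by have := H x; rewrite lU glueE; exact.
Qed.

Lemma sumo_agree U l (s : {ffun U -> bool}) g w : uniq l -> l =i U ->
  sumo l (fun w' => (agree s w')%:R * g w') w = g (Defs.glue s w).
Proof.
move=> ul lU; under eq_sumo do rewrite (agree_all s _ w lU).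
rewrite sumo_pin//; congr g; apply/funext => x.
by rewrite lU; case: ifPn => // xU; rewrite glue_out.
Qed.

Lemma sumo_ffun U l g w : uniq l -> l =i U ->
  sumo l g w = \sum_(s : {ffun U -> bool}) g (Defs.glue s w).
Proof.
move=> ul lU; have -> : g = fun w' => \sum_(s : {ffun U -> bool}) (agree s w')%:R * g w'.
  by apply/funext => w'; rewrite -mulr_suml sum_agree1 mul1r.
rewrite sumo_sum; apply: eq_bigr => s _; rewrite sumo_agree//.
by rewrite -mulr_suml sum_agree1 mul1r.
Qed.

(** Both sums run over the spin patterns on the same finite set [U]. *)
Lemma sumo_perm l l' g w : uniq l -> uniq l' -> l =i l' -> sumo l g w = sumo l' g w.
Proof.
move=> ul ul' ll'; pose U := [fset x in l]%fset.
have lU : l =i U by move=> x; rewrite !inE.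
by rewrite (sumo_ffun _ _ ul lU) (@sumo_ffun U l')// => x; rewrite -ll'.
Qed.

Lemma sumo_cat l1 l2 g w : sumo (l1 ++ l2) g w = sumo l1 (sumo l2 g) w.
Proof. by rewrite /sumo foldr_cat. Qed.

Definition spin_prob (p : V -> conf -> R) v w : R := if w v then p v w else 1 - p v w.
Definition weight p l w : R := \prod_(v <- l) spin_prob p v w.

Definition parent_local (p : V -> conf -> R) :=
  forall v, local_on [pred x | parent v == Some x] (p v).

Lemma spin_prob_local p v : parent_local p ->
  local_on [pred x | (x == v) || (parent v == Some x)] (spin_prob p v).
Proof.
move=> pp w1 w2 ww; rewrite /spin_prob (ww v) /= ?eqxx//.
by rewrite (pp v w1 w2)// => x /= vx; apply: ww; rewrite /= vx orbT.
Qed.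

Lemma parent_neq v x : parent v == Some x -> x != v.
Proof. by move=> /eqP/idx_parent; apply: contraTneq => ->; rewrite ltnn. Qed.

(** The factor at [v] depends on [v] and its parent only. As later vertices have larger indices, it
    is constant for the remaining sums and can be moved inside them. *)
Lemma expectE p l f w : parent_local p -> idx_sorted l ->
  expect p l f w = sumo l (fun w' => weight p l w' * f w') w.
Proof.
move=> pp; elim: l w => [|v l IH] w sl /=.
  by rewrite /weight big_nil mul1r.
move: sl; rewrite /idx_sorted /= => /andP[/allP vl sl].
have E b w' : spin_prob p v (upd w' v b) = if b then p v w' else 1 - p v w'.
  rewrite /spin_prob upd_same (pp v _ w')// => x /= /parent_neq xv.
  by rewrite upd_neq.
have -> g : step p v g w = sum1 v (fun w' => spin_prob p v w' * g w') w.
  by rewrite /step /sum1 !E.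
rewrite /sum1.
have L b : spin_prob p v (upd w v b) * sumo l (fun w' => weight p l w' * f w') (upd w v b) =
    sumo l (fun w' => weight p (v :: l) w' * f w') (upd w v b).
  rewrite sumo_mull => [|w1 w2 ww].
    by apply: eq_sumo => w'; rewrite /weight big_cons mulrA.
  apply: spin_prob_local => // x /= xv; apply: ww => /=.
  case/orP: xv => [/eqP ->|/eqP/idx_parent xv].
    by apply/negP => /vl; rewrite ltnn.
  by apply/negP => /vl; rewrite ltnNge (ltnW xv).
by rewrite !IH// !L.
Qed.

End weights.

(** * Gibbs weights as Markov chains with local fields *)
Section fields.
Context {R : realType} (d : nat).
Local Notation V := (vertex d).
Local Notation conf := (V -> bool).
Implicit Types (w : conf) (v : V) (l : seq V) (U : {fset V}) (a : V -> R) (J h : R).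

Definition logistic (x : R) : R := expR x / (expR x + expR (- x)).

Let denom_gt0 (x : R) : 0 < expR x + expR (- x).
Proof. by rewrite addr_gt0 ?expR_gt0. Qed.

Lemma logisticN x : 1 - logistic x = logistic (- x).
Proof.
rewrite /logistic opprK [expR (- x) + _]addrC.
by field; rewrite gt_eqF.
Qed.

Lemma logistic_gt0 x : 0 < logistic x.
Proof. by rewrite divr_gt0 ?expR_gt0. Qed.

Lemma logistic_lt1 x : logistic x < 1.
Proof. by rewrite -subr_gt0 logisticN logistic_gt0. Qed.

Lemma ler_logistic : {mono logistic : x y / x <= y}.
Proof.
apply: le_mono => x y xy.
have E z : logistic z = (1 + expR (- (z + z)))^-1.
  rewrite /logistic opprD expRD; have := expR_gt0 z; rewrite expRN => z0.
  by field; rewrite gt_eqF//= gt_eqF//; have := mulr_gt0 z0 z0; nra.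
rewrite !E ltf_pV2 ?posrE ?addr_gt0 ?expR_gt0// ltrD2l ltr_expR; lra.
Qed.

Lemma continuous_logistic : continuous logistic.
Proof.
move=> x; apply: cvgM; first exact: continuous_expR.
apply: cvgV; first by rewrite gt_eqF.
apply: cvgD; first exact: continuous_expR.
apply: (@continuous_comp _ _ _ (fun z : R => - z) expR); last exact: continuous_expR.
exact: opp_continuous.
Qed.

(** The value [0] at the root removes the interaction with a parent. *)
Definition pspin w v : R := if parent v is Some p then spin (w p) else 0.

Definition field_kernel J a v w : R := logistic (a v + J * pspin w v).

Lemma field_kernel_bounds J a : kernel_bounds (field_kernel J a).
Proof. by move=> v w; rewrite ltW ?logistic_gt0// ltW// logistic_lt1. Qed.

Lemma field_kernel_local J a : parent_local (field_kernel J a).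
Proof.
move=> v w1 w2 ww; rewrite /field_kernel /pspin.
by case vp: (parent v) => [p|//]; rewrite ww//= vp.
Qed.

Lemma le_spin (b c : bool) : b ==> c -> spin b <= spin c :> R.
Proof. by case: b c => -[]//= _; rewrite /spin; lra. Qed.

Lemma le_pspin w1 w2 v : wle w1 w2 -> pspin w1 v <= pspin w2 v.
Proof. by rewrite /pspin; case: (parent v) => [p|//] ww; exact: le_spin. Qed.

Lemma field_kernel_mono J a : 0 <= J -> kernel_mono (field_kernel J a).
Proof.
by move=> J0 v w1 w2 ww; rewrite ler_logistic lerD2l ler_wpM2l// le_pspin.
Qed.

(** As a function of the parent spin [s], the log normalisation [ln (2 cosh (a v + J s))] is its
    average over [s] plus [s * phi J (a v)]. The average is kept here; the other term goes into
    [log_prob]. *)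
Definition log_norm J a v : R := if parent v is Some p
  then ln 2 + (ln (cosh (a v + J)) + ln (cosh (a v - J))) / 2
  else ln 2 + ln (cosh (a v)).

Definition log_prob J a v w : R :=
  spin (w v) * a v + pspin w v * (J * spin (w v) - phi J (a v)) - log_norm J a v.

Lemma spin_prob_log J a v w :
  spin_prob (field_kernel J a) v w = expR (log_prob J a v w).
Proof.
have D (z : R) : expR z + expR (- z) = expR (ln 2 + ln (cosh z)).
  by rewrite expRD !lnK ?posrE ?cosh_gt0// /cosh; field.
transitivity
    (expR (spin (w v) * (a v + J * pspin w v) - (ln 2 + ln (cosh (a v + J * pspin w v))))).
  rewrite /spin_prob /field_kernel logisticN expRD expRN -D /spin.
  by case: (w v); rewrite /logistic ?mul1r ?mulN1r// opprK [in RHS](addrC (expR (a v + _))).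
congr expR; rewrite /log_prob /log_norm /pspin phiE.
by case: (parent v) => [p|]; rewrite ?mulr0 ?mul0r ?addr0//;
  case: (w p); rewrite /spin ?mulrN1 ?mulr1; field.
Qed.

Lemma weight_log J a l w :
  weight (field_kernel J a) l w = expR (\sum_(v <- l) log_prob J a v w).
Proof.
rewrite /weight expR_sum; apply: eq_bigr => v _; exact: spin_prob_log.
Qed.

Definition parent_in U v := if parent v is Some p then p \in U else false.

(** Double counting of edges, by their lower or by their upper endpoint. *)
Lemma sum_parent_in U l (H : V -> R) : uniq l ->
  \sum_(y <- l | parent_in U y) H y =
  \sum_(x <- U) \sum_(y <- children x | y \in l) H y.
Proof.
move=> ul.
transitivity (\sum_(x <- U) \sum_(y <- l | parent y == Some x) H y); last first.
  apply: eq_bigr => x _; rewrite -big_filter -[RHS]big_filter.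
  apply: perm_big; apply: uniq_perm; rewrite ?filter_uniq ?uniq_children// => y.
  by rewrite !mem_filter mem_children andbC.
rewrite (exchange_big_dep predT)//= big_mkcond/=; apply: eq_bigr => y _.
rewrite /parent_in; case: (parent y) => [p|]; last by rewrite big_pred0.
rewrite big_mkcond/=; case: ifPn => pU.
  rewrite (bigD1_seq p) ?fset_uniq//= eqxx big1 ?addr0// => x xp.
  by case: eqP => // -[px]; move: xp; rewrite px eqxx.
rewrite big_seq big1// => x xU; case: eqP => // -[px].
by move: pU; rewrite px xU.
Qed.

(** An edge touching [U] either goes down from a vertex of [U], or goes up from a vertex of [U] to a
    parent outside. *)
Lemma energyE J h U w : energy J h U w =
  J * (\sum_(x <- U) \sum_(y <- children x) spin (w x) * spin (w y)
       + \sum_(x <- U | ~~ parent_in U x) spin (w x) * pspin w x)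
  + h * \sum_(x <- U) spin (w x).
Proof.
rewrite /energy; congr (J * _ + _).
rewrite [X in _ + X = _](_ : _ = \sum_(x <- U | ~~ parent_in U x) spin (w x) * pspin w x
    + \sum_(x <- U) \sum_(y <- children x | y \notin U) spin (w x) * spin (w y)).
  rewrite addrCA addrC -big_split/=; congr (_ + _); apply: eq_bigr => x _.
  by rewrite [RHS](bigID (mem U)).
rewrite [X in _ = X + _]big_mkcond -big_split/=; apply: eq_bigr => x _.
rewrite /nbrs big_cat/=; congr (_ + _).
rewrite /parent_in /pspin; case: (parent x) => [p|]; last by rewrite big_nil mulr0.
by rewrite big_mkcond big_seq1.
Qed.

(** The part of the log weight left beside the energy of [U]. It sees no spin in [U], hence cancels
    when the weight is normalised over [U]. *)
Definition outer_log J a l U w : R :=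
  \sum_(v <- l | v \notin U) spin (w v) * a v
  + \sum_(v <- l | (v \notin U) && ~~ parent_in U v)
      pspin w v * (J * spin (w v) - phi J (a v))
  - \sum_(v <- l | (v \in U) && ~~ parent_in U v) pspin w v * phi J (a v)
  - \sum_(v <- l) log_norm J a v.

Lemma outer_log_local J a l U : local_on [pred x | x \notin U] (outer_log J a l U).
Proof.
move=> w1 w2 ww; rewrite /outer_log.
have P v : ~~ parent_in U v -> pspin w1 v = pspin w2 v.
  by rewrite /parent_in /pspin; case: (parent v) => [p|//] pU; rewrite ww.
congr (_ + _ - _ - _); apply: eq_bigr => v.
- by move=> vU; rewrite ww.
- by move=> /andP[vU pU]; rewrite ww// P.
- by move=> /andP[vU pU]; rewrite P.
Qed.

(* Local fields satisfying the recursion absorb the interaction with the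
   subtrees, which is how the chain reproduces the Ising energy on [U] *)
Lemma sum_log_prob J h a l U w : uniq l -> {subset U <= l} ->
  {in U, forall x, a x = h + \sum_(y <- children x | y \in l) phi J (a y)
                        + J * \sum_(y <- children x | y \notin l) spin (w y)} ->
  \sum_(v <- l) log_prob J a v w = energy J h U w + outer_log J a l U w.
Proof.
move=> ul Ul aE; rewrite energyE /log_prob sumrB /outer_log !addrA; congr (_ - _).
rewrite big_split/=.
have UE (F : V -> R) : \sum_(x <- U) F x = \sum_(v <- l | v \in U) F v.
  rewrite -[RHS]big_filter; apply: perm_big; apply: uniq_perm; rewrite ?filter_uniq ?fset_uniq//.
  by move=> x; rewrite mem_filter; case: (boolP (x \in U)) => //= /Ul ->.
have UE' (F : V -> R) : \sum_(x <- U | ~~ parent_in U x) F x =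
    \sum_(v <- l | (v \in U) && ~~ parent_in U v) F v.
  by rewrite big_mkcond UE [RHS]big_mkcondr.
have S1 : \sum_(v <- l) spin (w v) * a v = \sum_(v <- l | v \notin U) spin (w v) * a v
   + (h * \sum_(x <- U) spin (w x)
   + \sum_(x <- U) \sum_(y <- children x | y \in l) spin (w x) * phi J (a y)
   + J * \sum_(x <- U) \sum_(y <- children x | y \notin l) spin (w x) * spin (w y)).
  rewrite (bigID (mem U))/= addrC -UE; congr (_ + _).
  rewrite !mulr_sumr -!big_split/= big_seq [RHS]big_seq; apply: eq_bigr => x xU.
  by rewrite aE// !mulr_sumr !mulrDr !mulr_sumr mulrC; congr (_ + _ + _);
    apply: eq_bigr => y _; rewrite mulrCA.
have S2 : \sum_(v <- l) pspin w v * (J * spin (w v) - phi J (a v)) =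
    \sum_(v <- l | (v \notin U) && ~~ parent_in U v) pspin w v * (J * spin (w v) - phi J (a v))
  - \sum_(v <- l | (v \in U) && ~~ parent_in U v) pspin w v * phi J (a v)
  + J * \sum_(x <- U | ~~ parent_in U x) spin (w x) * pspin w x
  + J * \sum_(x <- U) \sum_(y <- children x | y \in l) spin (w x) * spin (w y)
  - \sum_(x <- U) \sum_(y <- children x | y \in l) spin (w x) * phi J (a y).
  rewrite (bigID (parent_in U))/= sum_parent_in//.
  rewrite [X in X + _ = _](_ : _ =
     J * \sum_(x <- U) \sum_(y <- children x | y \in l) spin (w x) * spin (w y)
     - \sum_(x <- U) \sum_(y <- children x | y \in l) spin (w x) * phi J (a y)).
    rewrite addrC addrA; congr (_ + _ - _).
    rewrite (bigID (mem U))/= UE'.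
    rewrite [X in X + _ = _](eq_bigl (fun v => (v \in U) && ~~ parent_in U v)); last first.
      by move=> v; rewrite andbC.
    rewrite [X in _ + X = _](eq_bigl (fun v => (v \notin U) && ~~ parent_in U v)); last first.
      by move=> v; rewrite andbC.
    rewrite [X in X + _ = _](_ : _ =
      J * \sum_(v <- l | (v \in U) && ~~ parent_in U v) spin (w v) * pspin w v
      - \sum_(v <- l | (v \in U) && ~~ parent_in U v) pspin w v * phi J (a v)).
      by ring.
    by rewrite mulr_sumr -sumrB; apply: eq_bigr => v _; ring.
  rewrite mulr_sumr -sumrB; apply: eq_bigr => x _.
  rewrite mulr_sumr -sumrB big_seq_cond [RHS]big_seq_cond; apply: eq_bigr => y.
  rewrite mem_children => /andP[/eqP yx _]; rewrite /pspin yx; ring.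
have S3 : \sum_(x <- U) \sum_(y <- children x) spin (w x) * spin (w y) =
    \sum_(x <- U) \sum_(y <- children x | y \in l) spin (w x) * spin (w y)
    + \sum_(x <- U) \sum_(y <- children x | y \notin l) spin (w x) * spin (w y) :> R.
  by rewrite -big_split/=; apply: eq_bigr => x _; rewrite (bigID (mem l)).
(* The sums of [spin (w x) * phi J (a y)] over children in [l] come from the field recursion in [S1]
   and from the normalisations in [S2], with opposite signs. *)
by rewrite S1 S2 S3; ring.
Qed.

End fields.

(** * Local functions *)
Section local_functions.
Context {R : realType} (d : nat).
Local Notation V := (vertex d).
Local Notation conf := (V -> bool).
Implicit Types (w : conf) (v : V) (l : seq V) (U : {fset V}).

Lemma measurable_coord v b : measurable [set w : config d | w v = b].
Proof. by apply: sub_sigma_algebra; exists v, b. Qed.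

Lemma measurable_agree U (s : {ffun U -> bool}) :
  measurable [set w : config d | agree s w].
Proof.
rewrite (_ : [set w : config d | agree s w] =
    \big[setI/setT]_(u : U) [set w : config d | w (val u) = s u]).
  by apply: bigsetI_measurable => u _; exact: measurable_coord.
apply/seteqP; split=> w; rewrite -bigcap_seq/= => H.
  by move=> u _/=; apply/eqP; move/forallP: H; exact.
by apply/forallP => u; apply/eqP/H => /=; rewrite mem_index_enum.
Qed.

Definition locally_on U (T : Type) (f : conf -> T) := local_on [pred x | x \in U] f.

(** Exactly one pattern on [U] agrees with [w]. Local functions thus are finite combinations of
    indicators, whence their measurability, boundedness and integrals. *)
Lemma locally_onE U (f : conf -> R) w0 w : locally_on U f ->
  f w = \sum_(s : {ffun U -> bool}) f (Defs.glue s w0) * (agree s w)%:R.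
Proof.
move=> lf; under eq_bigr do rewrite mulrC.
rewrite sum_agree; apply: lf => x /= xU.
by rewrite glueE ffunE.
Qed.

Lemma measurable_agree_fun U (s : {ffun U -> bool}) :
  measurable_fun setT (fun w : config d => (agree s w)%:R : R).
Proof.
rewrite (_ : (fun w : config d => (agree s w)%:R : R) = \1_[set w : config d | agree s w]).
  by apply: measurable_indic; exact: measurable_agree.
by apply/funext => w; rewrite indicE; congr (nat_of_bool _)%:R; apply/idP/idP; rewrite inE.
Qed.

Lemma locally_on_measurable U (f : conf -> R) : locally_on U f ->
  measurable_fun setT (f : config d -> R).
Proof.
move=> lf; rewrite (_ : f = (fun w : config d =>
    \sum_(s : {ffun U -> bool}) f (Defs.glue s (fun=> false)) * (agree s w)%:R)).
  apply: measurable_sum => s; apply: measurable_funM => //.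
  exact: measurable_agree_fun.
by apply/funext => w; exact: locally_onE.
Qed.

Lemma locally_on_measurable_set U (A : set (config d)) : locally_on U A ->
  measurable A.
Proof.
move=> lA; apply/(measurable_indicP R).
apply: (@locally_on_measurable U) => w1 w2 ww.
rewrite !indicE; congr (nat_of_bool _)%:R.
by apply/idP/idP; rewrite !inE (lA w1 w2).
Qed.

Lemma locally_on_bounded U (f : conf -> R) : locally_on U f ->
  exists M : R, forall w, `|f w| <= M.
Proof.
move=> lf; exists (\sum_(s : {ffun U -> bool}) `|f (Defs.glue s (fun=> false))|) => w.
rewrite (locally_onE (fun=> false) w lf).
apply: le_trans (ler_norm_sum _ _ _) _; apply: ler_sum => s _.
by rewrite normrM ler_piMr//; case: (agree s w); rewrite ?normr1 ?normr0.
Qed.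

Variable nu : probability (config d) R.

Lemma bounded_integrable (f : config d -> R) (M : R) : measurable_fun setT f ->
  (forall w, `|f w| <= M) -> nu.-integrable setT (EFin \o f).
Proof.
move=> mf bf; apply: measurable_bounded_integrable => //.
  by rewrite ltey_eq fin_num_measure.
exists M; split; first exact: num_real.
by move=> N MN w _; exact: le_trans (bf w) (ltW MN).
Qed.

Lemma locally_on_integrable U (f : conf -> R) : locally_on U f ->
  nu.-integrable setT (EFin \o (f : config d -> R)).
Proof.
move=> lf; have [M bM] := locally_on_bounded lf.
by apply: bounded_integrable bM; exact: locally_on_measurable lf.
Qed.

Lemma integral_locally_on U (f : conf -> R) w0 : locally_on U f ->
  (\int[nu]_w (f w)%:E = \sum_(s : {ffun U -> bool})
     (f (Defs.glue s w0))%:E * nu [set w : config d | agree s w])%E.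
Proof.
move=> lf.
have mA (s : {ffun U -> bool}) := measurable_agree s.
have iA (s : {ffun U -> bool}) : nu.-integrable setT
    (fun w : config d => (\1_[set w : config d | agree s w] w)%:E).
  apply: (@bounded_integrable _ 1).
    exact: measurable_indic.
  by move=> w; rewrite indicE; case: (_ \in _); rewrite ?normr1 ?normr0.
transitivity (\int[nu]_w (\sum_(s : {ffun U -> bool})
   ((f (Defs.glue s w0))%:E * (\1_[set w : config d | agree s w] w)%:E)))%E.
  apply: eq_integral => w _; rewrite (locally_onE w0 w lf) -sumEFin.
  apply: eq_bigr => s _; rewrite EFinM indicE; congr (_ * (nat_of_bool _)%:R%:E)%E.
  by apply/idP/idP; rewrite inE.
rewrite integral_sum//; last by move=> s; exact: integrableZl.
apply: eq_bigr => s _; rewrite integralZl//.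
by rewrite integral_indic// setIT.
Qed.

End local_functions.

(** * Existence of chains *)
Section chain_law.
Context {R : realType} (d : nat).
Local Notation V := (vertex d).
Local Notation conf := (V -> bool).
Variable p : V -> conf -> R.
Hypothesis bp : kernel_bounds p.
Implicit Types (w : conf) (v : V) (l : seq V) (a len u : R) (A : set conf).
Local Notation mu := (@lebesgue_measure R).

(* Splitting [[a, a + len[] according to the sampling probabilities turns a
   uniform real [u] into a configuration. *)
Fixpoint run l w a len u : conf :=
  if l is v :: l' then
    if u < a + len * p v w then run l' (upd w v true) a (len * p v w) u
    else run l' (upd w v false) (a + len * p v w) (len * (1 - p v w)) u
  else w.

Lemma measurable_run l w a len A :
  measurable [set u : measurableTypeR R | A (run l w a len u)].
Proof.
elim: l w a len => [|v l IH] w a len /=.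
  have [Aw|nAw] := pselect (A w).
    by rewrite (_ : [set _ | _] = setT)//; apply/seteqP; split.
  by rewrite (_ : [set _ | _] = set0)//; apply/seteqP; split.
set m := a + len * p v w.
rewrite (_ : [set _ | _] =
    (`]-oo, m[%classic `&` [set u | A (run l (upd w v true) a (len * p v w) u)]) `|`
    (`[m, +oo[%classic `&` [set u | A (run l (upd w v false) m (len * (1 - p v w)) u)])).
  by apply: measurableU; apply: measurableI.
apply/seteqP; split=> u /=; rewrite !in_itv/= andbT.
  by case: ltP => um; [left|right].
by case: ltP => um [[]|[]].
Qed.

(** The cut at [m] gives each spin a subinterval of length proportional to its probability, and the
    induction continues inside it. *)
Lemma run_mass l w a len A : 0 <= len ->
  mu (`[a, a + len[%classic `&` [set u | A (run l w a len u)]) =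
  (len * expect p l (\1_A) w)%:E.
Proof.
elim: l w a len => [|v l IH] w a len len0 /=.
  rewrite indicE; have [Aw|nAw] := pselect (A w).
    rewrite (_ : [set u | A w] = setT); last by apply/seteqP; split.
    rewrite setIT mem_set// mulr1 lebesgue_measure_itv/= lte_fin ltrDl.
    case: ltP => [_|len0']; first by rewrite -EFinB addrAC subrr add0r.
    by congr EFin; apply/eqP; rewrite eq_le len0 len0'.
  rewrite (_ : [set u | A w] = set0); last by apply/seteqP; split.
  by rewrite setI0 measure0 memNset// mulr0.
have /andP[p0 p1] := bp v w.
set m := a + len * p v w.
have ml : m + len * (1 - p v w) = a + len by rewrite /m; ring.
rewrite (_ : _ `&` _ =
    (`[a, a + len * p v w[%classic `&`
       [set u | A (run l (upd w v true) a (len * p v w) u)]) `|`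
    (`[m, m + len * (1 - p v w)[%classic `&`
       [set u | A (run l (upd w v false) m (len * (1 - p v w)) u)])).
  rewrite measureU; first last.
  - rewrite -subset0 => u /= [[+ _] [+ _]]; rewrite !in_itv/= -/m.
    by move=> /andP[_ um] /andP[mu _]; move: um; rewrite ltNge mu.
  - by apply: measurableI => //; exact: measurable_run.
  - by apply: measurableI => //; exact: measurable_run.
  etransitivity; first by apply: (congr2 (fun x y : \bar R => (x + y)%E)); apply: IH;
    rewrite mulr_ge0// subr_ge0.
  by rewrite /= -EFinD /step; congr EFin; ring.
rewrite ml; apply/seteqP; split=> u /=; rewrite !in_itv/= -/m.
  by case: (ltP u m) => um [/andP[au ul] Au]; [left|right]; rewrite ?au ?ul.
case: (ltP u m) => um [[/andP[au ul] Au]|[/andP[au ul] Au]]//; split=> //.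
- by rewrite au/= -ml (lt_le_trans um)// lerDl mulr_ge0// subr_ge0.
- by rewrite ul andbT (le_trans _ um)// lerDl mulr_ge0.
Qed.

Lemma run_cat l1 l2 w a len u x : x \notin l2 ->
  run (l1 ++ l2) w a len u x = run l1 w a len u x.
Proof.
elim: l1 w a len => [|v l IH] w a len xl /=; last by case: ifP => _; exact: IH.
elim: l2 w a len xl => [//|v l IH] w a len.
rewrite inE negb_or => /andP[xv xl] /=.
by case: ifP => _; rewrite IH// upd_neq.
Qed.

Let w0 : conf := fun=> false.

(** The spin at [v] is read after just enough steps to sample [v]. Later steps do not change it, so
    one configuration realises all finite runs. *)
Definition sample (u : measurableTypeR R) : config d := fun v => run (seg d (idx v).+1) w0 0 1 u v.

Lemma sampleE N u v : (idx v < N)%N -> sample u v = run (seg d N) w0 0 1 u v.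
Proof.
move=> vN; have [l El Hl] := seg_add d (idx v).+1 (N - (idx v).+1).
rewrite subnKC// in El; rewrite El run_cat//.
by apply/negP => /Hl; rewrite ltnn.
Qed.

Lemma measurable_sample : measurable_fun (setT : set (measurableTypeR R)) sample.
Proof.
apply: (@measurability _ _ (measurableTypeR R) (config d) setT sample (coord_events d)) => //.
move=> _ [_ [v [b ->]] <-]; rewrite setTI.
exact: (@measurable_run (seg d (idx v).+1) w0 0 1 [set w | w v = b]).
Qed.

HB.instance Definition _ := isMeasurableFun.Build _ _ (measurableTypeR R) (config d) sample measurable_sample.

Definition unit_mass := mrestr mu (measurable_itv `[0, 1[).
HB.instance Definition _ := Measure.on unit_mass.

Let unit_massT : unit_mass setT = 1%E.
Proof.
rewrite /unit_mass /mrestr setTI; apply: etrans (lebesgue_measure_itv _) _.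
by rewrite /= lte_fin ltr01 oppr0 adde0.
Qed.

HB.instance Definition _ := Measure_isProbability.Build _ _ _ unit_mass unit_massT.

Definition chain_law : probability (config d) R := distribution unit_mass sample.

Lemma chain_law_local N A : local_on [pred x | x \in seg d N] A ->
  chain_law A = (expect p (seg d N) (\1_A) w0)%:E.
Proof.
move=> lA; rewrite /chain_law/= /distribution /pushforward /unit_mass /mrestr setIC.
rewrite -[expect _ _ _ _ in RHS]mul1r -(@run_mass _ w0 0)// add0r; congr (mu (_ `&` _)).
apply/funext => u /=; apply: lA => x /= xN; apply: sampleE.
by rewrite -mem_seg.
Qed.

End chain_law.

(** * Domination is determined by local functions *)
Section local_domination.
Context {R : realType} (d : nat).
Local Notation V := (vertex d).
Local Notation conf := (V -> bool).
Implicit Types (w : conf) (v : V) (l : seq V) (U : {fset V}).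

Lemma near_coord (w : {ptws V -> bool}) v : \forall w' \near w, w' v = w v.
Proof.
have := @proj_continuous V (fun=> bool) v w.
by move=> /(_ [set w v] (discrete_set1 _)).
Qed.

Lemma locally_on_continuous U (f : {ptws V -> bool} -> R) : locally_on U f ->
  continuous f.
Proof.
move=> lf w; have F : Filter (nbhs w) := nbhs_filter w.
have H : \forall w' \near w, forall x, x \in U -> w' x = w x.
  have : forall l : seq V, \forall w' \near w, forall x, x \in l -> w' x = w x.
    elim=> [|v l IH]; first by apply: filterE => w' x; rewrite in_nil.
    apply: filterS2 (near_coord w v) IH => w' C IH x; rewrite inE => /orP[/eqP ->//|].
    exact: IH.
  by move=> /(_ (enum_fset U)).
apply: cvg_near_cst.
by apply: filterS H => w' H; exact: lf.
Qed.

(** Spins of index at least [N] become [-1]. Composing with [trunc N] makes a function local, keeps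
    it increasing, and approximates it pointwise if it is continuous. *)
Definition trunc N w : conf := fun v => if (idx v < N)%N then w v else false.

Lemma trunc_cvg w : trunc N w @[N --> \oo] --> (w : {ptws V -> bool}).
Proof.
apply/cvg_sup => v; apply/cvg_image.
  by apply/seteqP; split=> // b _; exists (fun=> b).
move=> B wB.
exists ((fun g : {ptws V -> bool} => g v) @^-1` B); last first.
  apply/seteqP; split=> [_ [g Bg <-]//|b Bb].
  by exists (fun=> b).
exists (idx v).+1 => // N /= vN; rewrite /trunc vN.
exact: nbhs_singleton.
Qed.

Lemma trunc_locally N (T : Type) (f : conf -> T) :
  locally_on [fset x in seg d N]%fset (f \o trunc N).
Proof.
move=> w1 w2 ww; rewrite /comp; congr f; apply/funext => v; rewrite /trunc.
by case: ifP => // vN; apply: ww; rewrite /= inE mem_seg.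
Qed.

Lemma measurable_trunc N (f : conf -> R) :
  measurable_fun setT (fun w : config d => f (trunc N w)).
Proof. by have /(@locally_on_measurable R d) := @trunc_locally N R f. Qed.

Lemma trunc_increasing N (f : conf -> R) : increasing f -> increasing (f \o trunc N).
Proof. by move=> incf w1 w2 ww; apply: incf => x; rewrite /trunc; case: ifP. Qed.

Lemma increasing_bounded (f : conf -> R) : increasing f ->
  exists M : R, forall w, `|f w| <= M.
Proof.
move=> incf; exists (`|f (fun=> true)| + `|f (fun=> false)|) => w.
have h1 : f w <= f (fun=> true) by apply: incf => x; rewrite implybT.
have h2 : f (fun=> false) <= f w by apply: incf.
have := ler_norm (f (fun=> true)); have := ler_norm (- f (fun=> false)).
have := normr_ge0 (f (fun=> true)); have := normr_ge0 (f (fun=> false)).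
by rewrite normrN ler_norml; lra.
Qed.

Lemma continuous_trunc_cvg (f : {ptws V -> bool} -> R) w : continuous f ->
  f (trunc N w) @[N --> \oo] --> f w.
Proof.
by move=> cf; apply: (@continuous_cvg _ _ _ _ _ _ f); [exact: cf|exact: trunc_cvg].
Qed.

Lemma continuous_measurable (f : {ptws V -> bool} -> R) : continuous f ->
  measurable_fun setT (f : config d -> R).
Proof.
move=> cf; apply: (@measurable_fun_cvg _ (config d) R setT
  (fun N (w : config d) => f (trunc N w))) => [N|w _].
- exact: measurable_trunc.
- exact: continuous_trunc_cvg.
Qed.

Lemma integral_trunc_cvg (nu : probability (config d) R) (f : {ptws V -> bool} -> R) :
  continuous f -> increasing f ->
  (\int[nu]_w (f (trunc N w))%:E @[N --> \oo] --> \int[nu]_w (f w)%:E)%E.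
Proof.
move=> cf incf; have [M bM] := increasing_bounded incf.
have [] // := @dominated_convergence _ _ _ nu setT measurableT
  (fun N w => (f (trunc N w))%:E) (fun w => (f w)%:E) (fun=> M%:E).
- by move=> N; apply/measurable_EFinP; exact: measurable_trunc.
- by apply/measurable_EFinP; exact: continuous_measurable.
- by apply: aeW => w _; apply: cvg_EFin; [exact: nearW|exact: continuous_trunc_cvg].
- apply: (@bounded_integrable _ _ nu (fun=> M) `|M|) => //.
- by apply: aeW => w N _; rewrite lee_fin.
Qed.

(** An increasing function lies between its values at the two constant configurations, so dominated
    convergence carries the inequality from [f \o trunc N] to [f]. *)
Lemma dominated_local (nu1 nu2 : probability (config d) R) :
  (forall N (f : conf -> R), locally_on [fset x in seg d N]%fset f -> increasing f ->
    (\int[nu1]_w (f w)%:E <= \int[nu2]_w (f w)%:E)%E) -> dominated nu1 nu2.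
Proof.
move=> H f cf incf.
have c1 := integral_trunc_cvg (nu := nu1) cf incf; have c2 := integral_trunc_cvg (nu := nu2) cf incf.
rewrite -(cvg_lim _ c1)// -(cvg_lim _ c2)//; apply: lee_lim.
- by apply/cvg_ex; eexists; exact: c1.
- by apply/cvg_ex; eexists; exact: c2.
apply: nearW => N; apply: (H N); first exact: trunc_locally.
exact: trunc_increasing.
Qed.

Lemma dominated_trans (nu1 nu2 nu3 : probability (config d) R) :
  dominated nu1 nu2 -> dominated nu2 nu3 -> dominated nu1 nu3.
Proof. by move=> H1 H2 f cf incf; exact: le_trans (H1 f cf incf) (H2 f cf incf). Qed.

End local_domination.

(** * Measures given by a density *)

Section density.
Context (disp : measure_display) (T : measurableType disp) {R : realType}.
Variables (mu : {measure set T -> \bar R}) (f : T -> \bar R).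
Hypotheses (mf : measurable_fun setT f) (f0 : forall x, (0 <= f x)%E).

(** With this the right-hand side of the Gibbs identity is a measure in the event, and uniqueness of
    measures can be applied. *)
Definition density (A : set T) : \bar R := (\int[mu]_(x in A) f x)%E.

Let density0 : density set0 = 0%E.
Proof. exact: integral_set0. Qed.

Let density_ge0 A : (0 <= density A)%E.
Proof. exact: integral_ge0. Qed.

Let density_sigma_additive : semi_sigma_additive density.
Proof.
move=> F mF tF mUF; rewrite /density ge0_integral_bigcup//; last first.
  exact: measurable_funTS.
by apply: is_cvg_ereal_nneg_natsum_cond => n _ _; exact: integral_ge0.
Qed.

HB.instance Definition _ := isMeasure.Build _ _ _ density
  density0 density_ge0 density_sigma_additive.

Definition density_measure : {measure set T -> \bar R} := density.

End density.

(** * Chains are Gibbs measures *)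
Section gibbs_chain.
Context {R : realType} (d : nat).
Local Notation V := (vertex d).
Local Notation conf := (V -> bool).
Implicit Types (w : conf) (v : V) (l : seq V) (U : {fset V}) (J h t : R).

Lemma integral_chain_law (p : V -> conf -> R) (bp : kernel_bounds p) N (f : conf -> R) :
  locally_on [fset x in seg d N]%fset f ->
  (\int[chain_law p]_w (f w)%:E)%E = (expect p (seg d N) f (fun=> false))%:E.
Proof.
move=> lf; rewrite (integral_locally_on _ (fun=> false) lf).
set U := [fset x in seg d N]%fset.
have E (s : {ffun U -> bool}) : chain_law p [set w : config d | agree s w] =
    (expect p (seg d N) (fun w => (agree s w)%:R) (fun=> false))%:E.
  rewrite (@chain_law_local _ _ _ bp N) => [|w1 w2 ww].
    congr (expect _ _ _ _)%:E; apply/funext => w; rewrite indicE.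
    by congr (nat_of_bool _)%:R; apply/idP/idP; rewrite inE.
  rewrite /=; congr is_true; apply: eq_forallb => -[x xU] /=; rewrite ww//=.
  by move: (xU); rewrite inE.
under eq_bigr do rewrite E -EFinM.
rewrite sumEFin -expect_sum; congr (expect _ _ _ _)%:E.
by apply/funext => w; rewrite -locally_onE.
Qed.

Lemma seq_bound l : exists N, forall x, x \in l -> (idx x < N)%N.
Proof.
elim: l => [|v l [N IH]]; first by exists 0%N.
exists (maxn N (idx v).+1) => x; rewrite inE leq_max => /orP[/eqP ->|/IH ->//].
by rewrite leqnn orbT.
Qed.

Lemma energy_local J h U l : {subset U <= l} -> parent_closed l ->
  {in U, forall x, {subset children x <= l}} ->
  local_on [pred x | x \in l] (energy J h U).
Proof.
move=> Ul cl chl w1 w2 ww.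
have E x : x \in U -> w1 x = w2 x by move=> xU; apply: ww; exact: Ul.
rewrite !energyE; congr (_ * (_ + _) + _ * _); rewrite big_seq_cond [RHS]big_seq_cond; apply: eq_bigr => x.
- move=> /andP[xU _]; rewrite big_seq [RHS]big_seq; apply: eq_bigr => y yx.
  by rewrite E// (ww y)//=; exact: chl yx.
- move=> /andP[xU _]; rewrite E//; congr (_ * _); rewrite /pspin.
  case px: (parent x) => [p|//]; rewrite ww//=.
  by apply: cl px; exact: Ul.
- by rewrite andbT => xU; rewrite E.
Qed.

Lemma gibbs_kernel_local J h U (D : pred V) (s : {ffun U -> bool}) :
  local_on D (energy J h U) ->
  local_on [pred x | D x && (x \notin U)] (gibbs_kernel J h U s).
Proof.
move=> le w1 w2 ww.
have E (s' : {ffun U -> bool}) : energy J h U (Defs.glue s' w1) = energy J h U (Defs.glue s' w2).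
  apply: le => x /= xl; have [xU|xU] := boolP (x \in U); first by rewrite !(glueE _ _ xU).
  by rewrite !glue_out//; apply: ww; rewrite /= xl xU.
by rewrite /gibbs_kernel E; congr (_ / _); apply: eq_bigr => s' _; rewrite E.
Qed.

Lemma gibbs_kernel_ge0 J h U (s : {ffun U -> bool}) w : 0 <= gibbs_kernel J h U s w.
Proof. by rewrite divr_ge0 ?expR_ge0// sumr_ge0// => s' _; exact: expR_ge0. Qed.

Lemma gibbs_sum_gt0 J h U w :
  0 < \sum_(s : {ffun U -> bool}) expR (energy J h U (Defs.glue s w)).
Proof.
rewrite (bigD1 [ffun=> false])//= ltr_pwDl ?expR_gt0//.
by apply: sumr_ge0 => s _; exact: expR_ge0.
Qed.

(** The sum over [l] is split into an outer sum off [U] and an inner sum over [U]. In the inner sum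
    [C], [D] and the kernel are constant: one side keeps the single term of [s], the other the
    kernel times the partition function. *)
Lemma sumo_gibbs J h U l p (C D : conf -> R) (s : {ffun U -> bool}) w0 :
  uniq l -> {subset U <= l} ->
  local_on [pred x | x \notin U] C -> local_on [pred x | x \notin U] D ->
  (forall w, weight p l w = expR (energy J h U w) * C w) ->
  sumo l (fun w => weight p l w * ((agree s w)%:R * D w)) w0 =
  sumo l (fun w => weight p l w * (gibbs_kernel J h U s w * D w)) w0.
Proof.
move=> ul Ul lC lD wE.
pose lu := [seq x <- l | x \in U]; pose lo := [seq x <- l | x \notin U].
have lul : lu =i U.
  by move=> x; rewrite mem_filter; case: (boolP (x \in U)) => //= /Ul.
have ulu : uniq lu by rewrite filter_uniq.
have ull : uniq (lo ++ lu).
  rewrite cat_uniq !filter_uniq//= andbT; apply/hasPn => x.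
  by rewrite !mem_filter => /andP[-> _].
have memll : l =i lo ++ lu.
  by move=> x; rewrite mem_cat !mem_filter -andb_orl orNb.
rewrite !(sumo_perm _ _ ul ull memll) !sumo_cat; apply: eq_sumo => w.
have lCD : local_on [pred x | x \notin lu] (fun w => C w * D w).
  by move=> w1 w2 ww; rewrite (lC w1 w2) ?(lD w1 w2)// => x /= xU; apply: ww;
    rewrite /= lul.
transitivity (C w * D w * expR (energy J h U (Defs.glue s w))).
  rewrite -(@sumo_agree _ _ U lu s (fun w => expR (energy J h U w)))//.
  rewrite (@sumo_mull _ _ lu _ (fun w => C w * D w))//; apply: eq_sumo => w'.
  by rewrite wE; ring.
have lK : local_on [pred x | x \notin lu]
    (fun w => C w * D w * gibbs_kernel J h U s w).
  move=> w1 w2 ww; rewrite (lCD w1 w2)//; congr (_ * _).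
  by apply: (@gibbs_kernel_local _ _ U predT) => [w3 w4 e|x /= xU];
    [congr energy; apply/funext => x; exact: e|apply: ww; rewrite /= lul].
rewrite [RHS](@eq_sumo _ _ _ _ (fun w' => C w' * D w' * gibbs_kernel J h U s w' *
    expR (energy J h U w'))); last by move=> w'; rewrite wE; ring.
rewrite -(sumo_mull _ _ lK) (sumo_ffun _ _ ulu lul) -[RHS]mulrA; congr (_ * _).
by rewrite /gibbs_kernel divfK// gt_eqF// gibbs_sum_gt0.
Qed.

End gibbs_chain.

(** * Homogeneous chains and the Gibbs identity *)

Section chain_is_gibbs.
Context {R : realType} (d : nat).
Local Notation V := (vertex d).
Local Notation conf := (V -> bool).
Implicit Types (w : conf) (v : V) (l : seq V) (U : {fset V}) (J h t : R).

(* The root has one more child than the other vertices. *)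
Definition chain_field J t v : R := if v == None then t + phi J t else t.

Definition chain J t : probability (config d) R :=
  chain_law (field_kernel J (chain_field J t)).

Lemma integral_chain J t N (f : conf -> R) :
  locally_on [fset x in seg d N]%fset f -> (\int[chain J t]_w (f w)%:E)%E =
  (expect (field_kernel J (chain_field J t)) (seg d N) f (fun=> false))%:E.
Proof. by move=> lf; apply: integral_chain_law lf; exact: field_kernel_bounds. Qed.

Lemma sum_children_cst v (c : R) : \sum_(y <- children v) c = c *+ size (children v).
Proof. by rewrite big_const_seq count_predT iter_addr_0. Qed.

Lemma children_neq_root v y : y \in children v -> y != None.
Proof. by rewrite mem_children; apply: contraTneq => ->. Qed.

Lemma chain_field_rec J h t v : fp_set d J h t ->
  chain_field J t v = h + \sum_(y <- children v) phi J (chain_field J t y).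
Proof.
move=> ft; rewrite big_seq (eq_bigr (fun=> phi J t)) => [|y yv]; last first.
  by rewrite /chain_field (negbTE (children_neq_root yv)).
rewrite -big_seq sum_children_cst size_children /chain_field.
case: eqP => _ /=; rewrite [X in X + _ = _]ft || rewrite [LHS]ft.
  by rewrite addn1 mulrSr addrA mulr_natl.
by rewrite addn0 mulr_natl.
Qed.

Lemma exists_seg U : exists N, forall M, (N <= M)%N ->
  {subset U <= seg d M} /\ {in U, forall x, {subset children x <= seg d M}}.
Proof.
have [N HN] := seq_bound (enum_fset U ++ flatten [seq children x | x <- enum_fset U]).
exists N => M NM; split=> [x xU|x xU y yx]; rewrite mem_seg (leq_trans _ NM)//.
  by apply: HN; rewrite mem_cat xU.
by apply: HN; rewrite mem_cat; apply/orP; right; apply/flatten_mapP; exists x.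
Qed.

Lemma gibbs_kernel_locally_on J h U (s : {ffun U -> bool}) : exists U',
  locally_on U' (gibbs_kernel J h U s).
Proof.
have [N /(_ N (leqnn N))[Ul chl]] := exists_seg U.
exists [fset x in seg d N]%fset => w1 w2 ww.
apply: (gibbs_kernel_local (D := [pred x | x \in seg d N])) => [|x /= /andP[xl _]].
  exact: energy_local (@parent_closed_seg _ N) chl.
by apply: ww; rewrite /= inE.
Qed.

(** Both sides are finite measures in [A]. The set [G] of events depending on finitely many spins
    off [U] is stable under intersection and contains the generators of the outer sigma-algebra; on
    [G] the identity is the finite computation [sumo_gibbs]. *)
Lemma chain_gibbs J h t : fp_set d J h t -> is_gibbs J h (chain J t).
Proof.
move=> ft U s A sA.
have [U' lK] := gibbs_kernel_locally_on J h s.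
have mK : measurable_fun setT (fun w : config d => (gibbs_kernel J h U s w)%:E).
  by apply/measurable_EFinP; exact: (locally_on_measurable lK).
have K0 (w : config d) : (0 <= (gibbs_kernel J h U s w)%:E)%E.
  by rewrite lee_fin gibbs_kernel_ge0.
have cylE : [set w : config d | forall u : U, w (val u) = s u] =
    [set w : config d | agree s w].
  apply/seteqP; split=> w /= H; first by apply/forallP => u; rewrite H.
  by move=> u; apply/eqP; move/forallP: H; exact.
rewrite cylE.
pose G : set (set (config d)) :=
  [set A | exists N, local_on [pred x | (x \in seg d N) && (x \notin U)] A].
have GM N A' M : (N <= M)%N ->
    local_on [pred x | (x \in seg d N) && (x \notin U)] A' ->
    local_on [pred x | (x \in seg d M) && (x \notin U)] (A' : set (config d)).
  move=> NM lA w1 w2 ww; apply: lA => x /= /andP[xN xU]; apply: ww => /=.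
  by rewrite xU andbT; move: xN; rewrite !mem_seg => xN; exact: leq_trans xN NM.
have GU N (A' : set (config d)) :
    local_on [pred x | (x \in seg d N) && (x \notin U)] A' ->
    locally_on [fset x in seg d N]%fset A'.
  move=> lA w1 w2 ww; apply: lA => x /= /andP[xN _]; apply: ww.
  by rewrite /= inE.
have G_measurable : G `<=` measurable.
  by move=> A' [N /GU]; exact: (locally_on_measurable_set (R := R)).
have G_setI : setI_closed G.
  move=> A1 A2 [N1 l1] [N2 l2]; exists (maxn N1 N2) => w1 w2 ww.
  rewrite /setI/=; congr (_ /\ _).
    exact: (GM _ _ _ (leq_maxl N1 N2) l1 w1 w2 ww).
  exact: (GM _ _ _ (leq_maxr N1 N2) l2 w1 w2 ww).
have GT : G setT by exists 0%N => w1 w2 _.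
have G_eq : forall A', G A' -> mrestr (chain J t) (measurable_agree s) A' =
    density_measure (chain J t) mK K0 A'.
  move=> A' [N0 lA0]; have [N1 HN1] := exists_seg U.
  (* The segment contains the vertices seen by [A'] as well as [U] with all its children, so no
     child of [U] acts as a boundary spin. *)
  pose N := maxn N0 N1.
  have {HN1}[Ul chl] := HN1 N (leq_maxr _ _).
  have lA := GM _ _ N (leq_maxl _ _) lA0.
  pose l := seg d N.
  have bk := field_kernel_bounds J (chain_field J t).
  have el : local_on [pred x | x \in l] (energy J h U).
    exact: energy_local (@parent_closed_seg _ N) chl.
  have lKl := gibbs_kernel_local s el.
  have lA' : local_on [pred x | (x \in l) && (x \notin U)] (fun w => \1_A' w : R).
    move=> w1 w2 ww; rewrite !indicE; congr (nat_of_bool _)%:R.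
    by apply/idP/idP; rewrite !inE (lA w1 w2).
  have -> : mrestr (chain J t) (measurable_agree s) A' =
      (expect (field_kernel J (chain_field J t)) l
        (fun w => (agree s w)%:R * \1_A' w) (fun=> false))%:E.
    rewrite /mrestr (@chain_law_local _ _ _ bk N) => [|w1 w2 ww].
      congr (expect _ _ _ _)%:E; apply/funext => w; rewrite !indicE -natrM mulnb.
      congr (nat_of_bool _)%:R; rewrite in_setI andbC; congr (_ && _).
      by apply/idP/idP; rewrite inE.
    rewrite /setI/=; congr (_ /\ _).
      by apply: lA => x /= /andP[xl _]; exact: ww.
    congr is_true; apply: eq_forallb => -[x xU] /=; rewrite ww//=.
    exact: Ul.
  have -> : density_measure (chain J t) mK K0 A' =
      (expect (field_kernel J (chain_field J t)) l
        (fun w => gibbs_kernel J h U s w * \1_A' w) (fun=> false))%:E.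
    rewrite -integral_chain_law//; last first.
      move=> w1 w2 ww; congr (_ * _); [apply: lKl|apply: lA'] => x /= /andP[xl _];
        by apply: ww; rewrite /= inE.
    rewrite /density_measure/= /density integral_mkcond; apply: eq_integral => w _.
    by rewrite patchE indicE; case: ifP; rewrite ?mulr1 ?mulr0.
  congr EFin; rewrite !expectE; [|exact: field_kernel_local|exact: idx_sorted_seg
    |exact: field_kernel_local|exact: idx_sorted_seg].
  apply: (@sumo_gibbs _ _ J h U l _
     (fun w => expR (outer_log J (chain_field J t) l U w))).
  - exact/idx_sorted_uniq/idx_sorted_seg.
  - exact: Ul.
  - by move=> w1 w2 ww; rewrite (@outer_log_local _ _ J (chain_field J t) l U w1 w2 ww).
  - by move=> w1 w2 ww; apply: lA' => x /= /andP[_]; exact: ww.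
  move=> w; rewrite weight_log -expRD; congr expR; apply: sum_log_prob.
  - exact/idx_sorted_uniq/idx_sorted_seg.
  - exact: Ul.
  move=> x xU; rewrite (chain_field_rec x ft).
  rewrite [X in J * X]big_seq_cond big_pred0 ?mulr0 ?addr0; last first.
    by move=> y; apply/negP => /andP[/(chl x xU) ->].
  congr (_ + _); rewrite big_seq [RHS]big_seq_cond; apply: eq_bigl => y.
  by case: (boolP (y \in children x)) => // /(chl x xU) ->.
have sGA : <<s G >> A.
  apply: (sub_smallest2r _ _ sA) => // _ [x [b [xU ->]]]; exists (idx x).+1.
  by move=> w1 w2 ww; rewrite /= ww//= xU mem_seg ltnS leqnn.
have := @g_sigma_algebra_measure_unique _ R (config d) G G_measurable (fun=> setT)
  (fun=> GT) _ (mrestr (chain J t) (measurable_agree s))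
  (density_measure (chain J t) mK K0) G_setI G_eq _ A sGA.
rewrite setIC; apply.
  by apply/seteqP; split=> // w _; exists 0%N.
by move=> k; rewrite ltey_eq fin_num_measure.
Qed.

End chain_is_gibbs.

(** * Gibbs measures lie between two chains *)
Section sandwich.
Context {R : realType} (d : nat) (J h : R).
Hypothesis J0 : 0 <= J.
Local Notation V := (vertex d).
Local Notation conf := (V -> bool).
Implicit Types (w eta : conf) (v : V) (l : seq V) (U : {fset V}) (bnd : V -> R).

(** The effective field at [v] after summing out [k] generations of descendants, the last of which
    carry the fields [bnd]. *)
Fixpoint subtree_field bnd k v : R :=
  if k is k'.+1 then h + \sum_(y <- children v) phi J (subtree_field bnd k' y)
  else bnd v.

Lemma subtree_fieldS bnd k v : subtree_field bnd k.+1 v =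
  h + \sum_(y <- children v) phi J (subtree_field bnd k y).
Proof. by []. Qed.

(** By truncated subtraction, every vertex of depth at least [n] has the field [bnd]. *)
Definition ball_field bnd n v : R := subtree_field bnd (n - depth v) v.

Definition bnd_of eta v : R := h + J * \sum_(y <- children v) spin (eta y).

Lemma le_subtree_field bnd1 bnd2 k v : (forall v, bnd1 v <= bnd2 v) ->
  subtree_field bnd1 k v <= subtree_field bnd2 k v.
Proof.
move=> bb; elim: k v => [//|k IH] v /=.
by rewrite lerD2l; apply: ler_sum => y _; exact: le_phi.
Qed.

Lemma le_bnd_of eta1 eta2 v : wle eta1 eta2 -> bnd_of eta1 v <= bnd_of eta2 v.
Proof.
by move=> ee; rewrite lerD2l ler_wpM2l//; apply: ler_sum => y _; exact: le_spin.
Qed.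

(** The hypothesis of [sum_log_prob] for a ball: the children of a vertex are all in the ball, or,
    at depth [n], all outside with spins given by [eta]. *)
Lemma ball_field_rec eta n N : (forall v, (depth v <= n)%N -> (idx v < N)%N) ->
  {in ball d n N, forall x, ball_field (bnd_of eta) n x =
    h + \sum_(y <- children x | y \in ball d n N) phi J (ball_field (bnd_of eta) n y)
    + J * \sum_(y <- children x | y \notin ball d n N) spin (eta y)}.
Proof.
move=> HN x; rewrite mem_filter => /andP[xn _].
have mem_ball y : (y \in ball d n N) = (depth y <= n)%N.
  by rewrite mem_filter; case: (boolP (depth y <= n)%N) => // /HN; rewrite mem_seg.
have [xn'|xn'] := ltnP (depth x) n.
  have H y : y \in children x -> y \in ball d n N.
    by move=> /depth_children yx; rewrite mem_ball yx.
  rewrite [X in J * X]big_seq_cond big_pred0 ?mulr0 ?addr0; last first.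
    by move=> y; apply/negP => /andP[/H ->].
  rewrite {1}/ball_field (_ : (n - depth x)%N = (n - (depth x).+1).+1); last by lia.
  rewrite /=; congr (_ + _); rewrite big_seq [RHS]big_seq_cond.
  apply: eq_big => y; first by case: (boolP (y \in children x)) => // /H ->.
  by move=> /depth_children yx; rewrite /ball_field yx.
have H y : y \in children x -> y \notin ball d n N.
  by move=> /depth_children yx; rewrite mem_ball yx -ltnNge ltnS.
rewrite [X in h + X]big_seq_cond big_pred0 ?addr0; last first.
  by move=> y; apply/negP => /andP[/H /negbTE ->].
rewrite /ball_field (_ : (n - depth x)%N = 0%N); last by lia.
rewrite /= /bnd_of; congr (_ + _ * _); rewrite big_seq [RHS]big_seq_cond.
by apply: eq_bigl => y; case: (boolP (y \in children x)) => // /H ->.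
Qed.

Definition ball_kernel eta n := field_kernel J (ball_field (bnd_of eta) n).

(** The chain weight is the Boltzmann weight times a factor [C] independent of [s]. The chain
    weights sum to one, so [C] is the inverse partition function. *)
Lemma gibbs_kernel_ball eta n N (U := [fset x in ball d n N]%fset) (s : {ffun U -> bool}) :
  (forall v, (depth v <= n)%N -> (idx v < N)%N) ->
  gibbs_kernel J h U s eta =
  weight (ball_kernel eta n) (ball d n N) (Defs.glue s eta).
Proof.
move=> HN; set l := ball d n N.
have lU : l =i U by move=> x; rewrite inE.
have ul : uniq l by exact/idx_sorted_uniq/idx_sorted_ball.
pose C := expR (outer_log J (ball_field (bnd_of eta) n) l U eta).
have wE (s' : {ffun U -> bool}) : weight (ball_kernel eta n) l (Defs.glue s' eta) =
    expR (energy J h U (Defs.glue s' eta)) * C.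
  rewrite weight_log /C.
  rewrite -(@outer_log_local _ _ J (ball_field (bnd_of eta) n) l U (Defs.glue s' eta)).
    rewrite -expRD; congr expR; apply: sum_log_prob => // [x|x].
      by rewrite lU.
    rewrite -lU => xl; rewrite {1}(ball_field_rec eta HN xl); congr (_ + _ * _).
    by apply: eq_bigr => y yl; rewrite glue_out// -lU.
  by move=> x /= xU; rewrite glue_out.
have sum1 : \sum_(s' : {ffun U -> bool}) expR (energy J h U (Defs.glue s' eta)) * C = 1.
  under eq_bigr do rewrite -wE.
  rewrite -(@sumo_ffun _ _ U l)// -[RHS](@expect_cst _ _ (ball_kernel eta n) l 1 eta).
  rewrite expectE; first by apply: eq_sumo => w; rewrite mulr1.
    exact: field_kernel_local.
  exact: idx_sorted_ball.
rewrite -mulr_suml in sum1.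
rewrite wE /gibbs_kernel; congr (_ * _).
have Z0 := gibbs_sum_gt0 J h U eta.
by apply: (mulfI (lt0r_neq0 Z0)); rewrite mulfV ?gt_eqF// sum1.
Qed.

(** The Gibbs identity, with the whole space as outer event, makes the integral of [f] an average
    over [eta] of the expectations in the ball; bounds uniform in [eta] pass to the average. *)
Lemma gibbs_integral_between (nu : probability (config d) R) n N (f : conf -> R) (lo hi : R) :
  is_gibbs J h nu -> (forall v, (depth v <= n)%N -> (idx v < N)%N) ->
  locally_on [fset x in ball d n N]%fset f ->
  (forall eta, lo <= expect (ball_kernel eta n) (ball d n N) f eta <= hi) ->
  (lo%:E <= \int[nu]_w (f w)%:E <= hi%:E)%E.
Proof.
move=> gnu HN lf lohi; set U := [fset x in ball d n N]%fset in lf *.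
have lU : ball d n N =i U by move=> x; rewrite inE.
pose g eta := \sum_(s : {ffun U -> bool}) f (Defs.glue s (fun=> false)) * gibbs_kernel J h U s eta.
have gE eta : g eta = expect (ball_kernel eta n) (ball d n N) f eta.
  rewrite expectE; [|exact: field_kernel_local|exact: idx_sorted_ball].
  rewrite (@sumo_ffun _ _ U)//; last exact/idx_sorted_uniq/idx_sorted_ball.
  apply: eq_bigr => s _; rewrite gibbs_kernel_ball// mulrC; congr (_ * _).
  by apply: lf => x /= xU; rewrite !(glueE _ _ xU).
have iK (s : {ffun U -> bool}) :
    nu.-integrable setT (fun w : config d => (gibbs_kernel J h U s w)%:E).
  have [U' lK] := gibbs_kernel_locally_on J h s.
  exact: (locally_on_integrable nu lK).
have lcK (s : {ffun U -> bool}) : exists U', locally_on U'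
    (fun w => f (Defs.glue s (fun=> false)) * gibbs_kernel J h U s w).
  have [U' lK] := gibbs_kernel_locally_on J h s.
  by exists U' => w1 w2 ww; congr (_ * _); exact: lK.
have iF (s : {ffun U -> bool}) : nu.-integrable setT (fun w : config d =>
    (f (Defs.glue s (fun=> false)) * gibbs_kernel J h U s w)%:E).
  by have [U' lK] := lcK s; exact: (locally_on_integrable nu lK).
have fg : (\int[nu]_w (f w)%:E = \int[nu]_w (g w)%:E)%E.
  rewrite (integral_locally_on nu (fun=> false) lf).
  under [RHS]eq_integral do rewrite -sumEFin.
  rewrite integral_sum//.
  apply: eq_bigr => s _; under eq_integral do rewrite EFinM.
  rewrite integralZl//; congr (_ * _)%E.
  rewrite -(gnu U s setT); last first.
    have [s0 sC _] := smallest_sigma_algebra setT (coord_events_out U).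
    by have := sC _ s0; rewrite setD0.
  rewrite setIT; congr (nu _); apply/seteqP; split=> w /= H.
    by move=> u; apply/eqP; move/forallP: H; exact.
  by apply/forallP => u; rewrite H.
have ig : nu.-integrable setT (fun w : config d => (g w)%:E).
  apply: (@bounded_integrable _ _ nu g (`|lo| + `|hi|)) => [|w].
    apply: measurable_sum => s; have [U' lK] := lcK s.
    exact: (locally_on_measurable lK).
  have /andP[h1 h2] := lohi w; rewrite -gE in h1 h2.
  have := ler_norm hi; have := ler_norm (- lo).
  have := normr_ge0 hi; have := normr_ge0 lo.
  by rewrite normrN ler_norml; lra.
have cst (c : R) : (\int[nu]_w c%:E = c%:E)%E.
  rewrite integral_cst// -[RHS]mule1; congr (_ * _)%E; exact: probability_setT.
have ic (c : R) : nu.-integrable setT (fun w : config d => c%:E).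
  by apply: (@bounded_integrable _ _ nu (fun=> c) `|c|).
rewrite fg; apply/andP; split.
  rewrite -(cst lo); apply: le_integral => // w _.
  by rewrite lee_fin gE; case/andP: (lohi w).
rewrite -(cst hi); apply: le_integral => // w _.
by rewrite lee_fin gE; case/andP: (lohi w).
Qed.

Lemma ball_field_cvg bnd (c T : R) v : (forall v, v != None -> bnd v = c) ->
  fp_set d J h T -> iter k (iter_field d J h) c @[k --> \oo] --> T ->
  ball_field bnd n v @[n --> \oo] --> chain_field J T v.
Proof.
move=> bc fT cT.
have E k x : x != None -> subtree_field bnd k x = iter k (iter_field d J h) c.
  elim: k x => [|k IH] x x0 /=; first exact: bc.
  rewrite big_seq (eq_bigr (fun=> phi J (iter k (iter_field d J h) c))).
    rewrite -big_seq sum_children_cst size_children (negbTE x0) addn0.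
    by rewrite /iter_field mulr_natl.
  by move=> y /children_neq_root y0; rewrite IH.
rewrite /chain_field; case: eqVneq => [->|v0].
  (* The last step of the recursion, at the root, sums over [d + 1] children and is not an iterate
     of [iter_field]. *)
  rewrite -(cvg_shiftS (fun n => ball_field bnd n None)).
  have -> : (fun n => ball_field bnd n.+1 None) =
      (fun n => h + phi J (iter n (iter_field d J h) c) *+ d.+1).
    apply/funext => n; rewrite /ball_field subn0 subtree_fieldS.
    rewrite big_seq (eq_bigr (fun=> phi J (iter n (iter_field d J h) c))).
      by rewrite -big_seq sum_children_cst size_children addn1.
    by move=> y /children_neq_root y0; rewrite E.
  have -> : T + phi J T = h + phi J T *+ d.+1.
    by rewrite {1}fT mulrSr addrA mulr_natl.
  apply: cvgD; first exact: cvg_cst.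
  apply: cvgMn; apply: continuous_cvg => //; exact: phi_continuous.
rewrite -(cvg_shiftn (depth v)).
have -> : (fun n => ball_field bnd (n + depth v)%N v) =
    (fun n => iter n (iter_field d J h) c).
  by apply/funext => n; rewrite /ball_field addnK E.
exact: cT.
Qed.

Lemma ball_kernel_cvg bnd (c T : R) v w : (forall v, v != None -> bnd v = c) ->
  fp_set d J h T -> iter k (iter_field d J h) c @[k --> \oo] --> T ->
  field_kernel J (ball_field bnd n) v w @[n --> \oo] -->
  field_kernel J (chain_field J T) v w.
Proof.
move=> bc fT cT; apply: continuous_cvg; first exact: continuous_logistic.
by apply: cvgD; [exact: ball_field_cvg bc fT cT|exact: cvg_cst].
Qed.

Lemma ball_split n N M : (M <= N)%N -> {in seg d M, forall v, depth v <= n}%N ->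
  exists2 l, ball d n N = seg d M ++ l & {in l, forall v, v \notin seg d M}.
Proof.
move=> MN HM; have [l El Hl] := seg_add d M (N - M).
rewrite subnKC// in El.
exists [seq v <- l | (depth v <= n)%N].
  by rewrite /ball El filter_cat; congr (_ ++ _); apply/all_filterP/allP.
by move=> v; rewrite mem_filter => /andP[_ /Hl]; rewrite mem_seg -leqNgt.
Qed.

Lemma depth_bound M : exists n0, {in seg d M, forall v, depth v <= n0}%N.
Proof.
elim: (seg d M) => [|v l [n IH]]; first by exists 0%N.
exists (maxn n (depth v)) => x; rewrite inE leq_max => /orP[/eqP ->|/IH ->//].
by rewrite leqnn orbT.
Qed.

Lemma expect_seg_local (p : V -> conf -> R) M (f : conf -> R) w1 w2 :
  parent_local p -> locally_on [fset x in seg d M]%fset f ->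
  expect p (seg d M) f w1 = expect p (seg d M) f w2.
Proof.
move=> pp lf; apply: (@expect_local _ _ p (seg d M) pred0) => //.
  move=> l1 v l2 el y1 y2 yy; apply: pp => x /= /eqP vx; apply: yy => /=.
  exact: parent_before (idx_sorted_seg d M) (@parent_closed_seg d M) el vx.
by move=> y1 y2 yy; apply: lf => x /=; rewrite inE => xM; apply: yy.
Qed.

(** Fields in the ball increase with the boundary spins, so the constant boundary conditions are
    extremal. Vertices outside [seg d M] are integrated out, which frees the bounds from the listing
    of the ball. *)
Lemma gibbs_between (nu : probability (config d) R) M (f : conf -> R) :
  is_gibbs J h nu -> locally_on [fset x in seg d M]%fset f -> increasing f ->
  exists n0, forall n, (n0 <= n)%N ->
  ((expect (ball_kernel (fun=> false) n) (seg d M) f (fun=> false))%:E <=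
   \int[nu]_w (f w)%:E <=
   (expect (ball_kernel (fun=> true) n) (seg d M) f (fun=> false))%:E)%E.
Proof.
move=> gnu lf incf; have [n0 Hn0] := depth_bound M; exists n0 => n nn.
have [N0 HN0] := idx_bound d n.
pose N := maxn N0 M.
have HN v : (depth v <= n)%N -> (idx v < N)%N.
  by move=> /HN0 vN; rewrite leq_max vN.
have HM : {in seg d M, forall v, depth v <= n}%N.
  by move=> v /Hn0 /leq_trans; exact.
have [l El Hl] := ball_split (leq_maxr N0 M) HM.
have bE p : expect p (ball d n N) f = expect p (seg d M) f.
  rewrite El expect_cat (@expect_id _ _ p l [pred x | x \in seg d M])//.
  by move=> w1 w2 ww; apply: lf => x /=; rewrite inE; exact: ww.
have kb eta := field_kernel_bounds J (ball_field (bnd_of eta) n).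
have km eta := @field_kernel_mono R d J (ball_field (bnd_of eta) n) J0.
have kle eta1 eta2 : wle eta1 eta2 ->
    forall v w, ball_kernel eta1 n v w <= ball_kernel eta2 n v w.
  move=> ee v w; rewrite ler_logistic lerD2r; apply: le_subtree_field => x.
  exact: le_bnd_of.
apply: (gibbs_integral_between gnu HN) => [w1 w2 ww|eta].
  apply: lf => x /=; rewrite inE => xM; apply: ww => /=.
  by rewrite inE El mem_cat xM.
rewrite !bE; apply/andP; split.
  apply: le_expect => //; [exact: kb|exact: kb|exact: km|].
  by move=> v w _; apply: kle.
(* The initial configuration must also lie above [eta]; it is then exchanged for the all-minus one,
   since [seg d M] contains the parents of its vertices. *)
apply: (@le_trans _ _ (expect (ball_kernel (fun=> true) n) (seg d M) f (fun=> true))).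
  apply: le_expect => //; [exact: kb|exact: kb|exact: km| |].
    by move=> v w _; apply: kle => x; rewrite implybT.
  by move=> x; rewrite implybT.
by rewrite (@expect_seg_local _ _ f _ (fun=> false))//; exact: field_kernel_local.
Qed.

End sandwich.

(** * Comparison of chains *)
Section gibbs_chain_bounds.
Context {R : realType} (d : nat) (J h : R).
Hypothesis J0 : 0 <= J.
Local Notation V := (vertex d).
Local Notation conf := (V -> bool).
Variable nu : probability (config d) R.
Hypothesis gnu : is_gibbs J h nu.

Let integral_fin M (f : conf -> R) : locally_on [fset x in seg d M]%fset f ->
  exists r : R, (\int[nu]_w (f w)%:E)%E = r%:E.
Proof.
move=> lf; have := integrable_fin_num measurableT (locally_on_integrable nu lf).
by move=> /fineK <-; eexists.
Qed.

(** The upper bounds of [gibbs_between] converge as the radius grows: under the plus boundary the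
    fields are the iterates started at [h + d J]. The lower bound below is the same after a sign
    change. *)
Lemma gibbs_le_chain : dominated nu (chain d J (t_plus d J h)).
Proof.
apply: dominated_local => M f lf incf.
have [r rE] := integral_fin lf.
have [n0 Hn0] := gibbs_between J0 gnu lf incf.
rewrite (integral_chain _ _ lf) rE lee_fin.
have [fp cv] := iter_field_cvg d J0 h.
apply: (cvgr_to_ge (F := \oo) (f := fun n =>
    expect (ball_kernel J h (fun=> true) n) (seg d M) f (fun=> false))).
  apply: (cvg_expect (p := ball_kernel J h (fun=> true))) => v w.
  apply: ball_kernel_cvg fp cv => x x0.
  by rewrite /bnd_of sum_children_cst size_children (negbTE x0) addn0 mulrC.
exists n0 => // n /= nn; have /andP[_] := Hn0 n nn.
by rewrite rE lee_fin.
Qed.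

Let iter_field_opp k : iter k (iter_field d J h) (h - d%:R * J) =
  - iter k (iter_field d J (- h)) (- h + d%:R * J).
Proof.
elim: k => [|k IH] /=; first by rewrite opprD opprK.
by rewrite IH /iter_field phiN mulrN opprD opprK.
Qed.

Lemma chain_le_gibbs : dominated (chain d J (t_minus d J h)) nu.
Proof.
apply: dominated_local => M f lf incf.
have [r rE] := integral_fin lf.
have [n0 Hn0] := gibbs_between J0 gnu lf incf.
rewrite (integral_chain _ _ lf) rE lee_fin.
have [_ cv] := iter_field_cvg d J0 (- h).
have {}cv : iter k (iter_field d J h) (h - d%:R * J) @[k --> \oo] --> t_minus d J h.
  by rewrite t_minusN; under eq_cvg do rewrite iter_field_opp; exact: cvgN.
apply: (cvgr_to_le (F := \oo) (f := fun n =>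
    expect (ball_kernel J h (fun=> false) n) (seg d M) f (fun=> false))).
  apply: (cvg_expect (p := ball_kernel J h (fun=> false))) => v w.
  apply: ball_kernel_cvg (fp_set_t_minus d J0 h) cv => x x0.
  rewrite /bnd_of sum_children_cst size_children (negbTE x0) addn0 mulrC.
  by rewrite /spin mulNrn mulNr.
exists n0 => // n /= nn; have /andP[+ _] := Hn0 n nn.
by rewrite rE lee_fin.
Qed.

End gibbs_chain_bounds.

(** * Domination between two chains *)

Section chain_comparison.
Context {R : realType} (d : nat).
Local Notation V := (vertex d).
Local Notation conf := (V -> bool).
Implicit Types (J t : R) (w : conf) (v : V) (l A : seq V) (b : bool).

(** This form shows that the root field increases in both [t + J] and [t - J]. *)
Lemma root_fieldE J t : t + phi J t =
  (ln (1 + expR (2 * (t + J))) - ln (1 + expR (- (2 * (t - J))))) / 2.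
Proof.
have L (x : R) : ln (cosh x) = - x + ln (1 + expR (2 * x)) - ln 2.
  have p : 0 < 1 + expR (2 * x) by rewrite addr_gt0 ?expR_gt0.
  rewrite -[- x in RHS]expRK -lnM ?posrE ?expR_gt0// -ln_div ?posrE ?mulr_gt0 ?expR_gt0//.
  by rewrite mulrDr mulr1 -expRD /cosh addrC; congr (ln ((_ + expR _) / _)); ring.
by rewrite phiE -[cosh (t - J)]coshN !L -mulrN; field.
Qed.

Lemma le_root_field J1 J2 t1 t2 : t1 + J1 <= t2 + J2 -> t1 - J1 <= t2 - J2 ->
  t1 + phi J1 t1 <= t2 + phi J2 t2.
Proof.
move=> H1 H2; rewrite !root_fieldE ler_wpM2r// lerB// ler_ln ?posrE ?addr_gt0 ?expR_gt0//.
  by rewrite lerD2l ler_expR ler_wpM2l.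
by rewrite lerD2l ler_expR lerN2 ler_wpM2l.
Qed.

(** The hypothesis amounts to [t1 + J1 <= t2 + J2] and [t1 - J1 <= t2 - J2]: the second chain has
    the larger field for either spin of the parent. *)
Lemma chain_dominated J1 J2 t1 t2 : 0 <= J2 -> t1 + `|J1 - J2| <= t2 ->
  dominated (chain d J1 t1) (chain d J2 t2).
Proof.
move=> J20 H; have := ler_norm (J1 - J2); have := ler_norm (- (J1 - J2)).
rewrite normrN => n1 n2.
have HP : t1 + J1 <= t2 + J2 by lra.
have HM : t1 - J1 <= t2 - J2 by lra.
apply: dominated_local => M f lf incf.
rewrite !(integral_chain _ _ lf) lee_fin; apply: le_expect => //.
- exact: field_kernel_bounds.
- exact: field_kernel_bounds.
- exact: field_kernel_mono.
move=> v w _; rewrite ler_logistic /chain_field /pspin.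
case: eqVneq => [->|/parent_some[p ->]] /=; first by rewrite !mulr0 !addr0 le_root_field.
by case: (w p); rewrite /spin ?mulrN1 ?mulr1.
Qed.

Lemma expectZ (p : V -> conf -> R) l (c : R) f w :
  expect p l (fun w' => c * f w') w = c * expect p l f w.
Proof. by elim: l w => [//|v l IH] w /=; rewrite /step !IH; ring. Qed.

(** When a vertex of [A] is sampled, its parent is in [A] and was sampled before. On the event so
    far the parent has spin [b], so the transition probability is the one at the constant
    configuration. *)
Lemma expect_const_spin (p : V -> conf -> R) A l b w : parent_local p ->
  idx_sorted l -> parent_closed l -> parent_closed A ->
  expect p l (fun w' => (all (fun x => w' x == b) [seq x <- l | x \in A])%:R) w =
  \prod_(v <- l | v \in A) spin_prob p v (fun=> b).
Proof.
move=> pp + + cA; elim/last_ind: l w => [|l v IH] w sl cl.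
  by rewrite big_nil.
have sl' : idx_sorted l.
  by move: sl; rewrite /idx_sorted -cats1 pairwise_cat => /and3P[].
have vl : v \notin l.
  by have := idx_sorted_uniq sl; rewrite rcons_uniq => /andP[].
have parv x : parent v = Some x -> x \in l.
  by move=> vx; apply: (parent_before sl cl _ vx (l2 := [::])); rewrite cats1.
have cl' : parent_closed l.
  move=> x y xl xy; have := cl x y; rewrite !mem_rcons !inE xl orbT => /(_ isT xy).
  case/orP => [/eqP yv|//].
  have /splitPr ll := xl; case: ll sl => l1 l2.
  rewrite /idx_sorted -cats1 pairwise_cat => /and3P[/allrelP H _ _].
  have := H x v; rewrite mem_cat mem_head orbT inE eqxx => /(_ isT isT).
  by rewrite -yv ltnNge (ltnW (idx_parent xy)).
rewrite -cats1 expect_cat big_cat/= [X in _ * X]big_mkcond big_seq1 filter_cat.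
rewrite -(IH w sl' cl') /expect/=.
have [vA|vA] := boolP (v \in A); last first.
  rewrite mulr1 cats0; congr (expect _ _ _ _); apply/funext => w'.
  have E c : all (fun x => upd w' v c x == b) [seq x <- l | x \in A] =
      all (fun x => w' x == b) [seq x <- l | x \in A].
    apply: eq_in_all => x; rewrite mem_filter => /andP[_ xl].
    by rewrite upd_neq//; apply: contraNneq vl => <-.
  by rewrite /step !E; ring.
rewrite mulrC -expectZ; congr (expect _ _ _ _); apply/funext => w'.
have E c : all (fun x => upd w' v c x == b) ([seq x <- l | x \in A] ++ [:: v]) =
    (c == b) && all (fun x => w' x == b) [seq x <- l | x \in A].
  rewrite all_cat /= upd_same andbT andbC; congr (_ && _).
  apply: eq_in_all => x; rewrite mem_filter => /andP[_ xl].
  by rewrite upd_neq//; apply: contraNneq vl => <-.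
rewrite /step !E; case: (boolP (all _ _)) => [/allP Hall|]; last first.
  by rewrite !andbF !mulr0 addr0.
have -> : p v w' = p v (fun=> b).
  apply: pp => x /= /eqP vx; apply/eqP; apply: Hall.
  by rewrite mem_filter (cA v x vA vx) parv.
by rewrite /spin_prob; case: b {E Hall IH} => /=; ring.
Qed.

(** If [q2 < q1], then [r2 * (q2 / q1) ^+ n] would tend to [0] while staying above [r1]. *)
Lemma le_base_of_le_expn (r1 r2 q1 q2 : R) : 0 < r1 -> 0 < q1 -> 0 <= q2 ->
  (forall n, r1 * q1 ^+ n <= r2 * q2 ^+ n) -> q1 <= q2.
Proof.
move=> r10 q10 q20 H; rewrite leNgt; apply/negP => q21.
have c : r2 * (q2 / q1) ^+ n @[n --> \oo] --> r2 * 0.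
  apply: cvgM; first exact: cvg_cst.
  apply: cvg_expr; rewrite ger0_norm ?divr_ge0// ?(ltW q10)//.
  by rewrite ltr_pdivrMr// mul1r.
suff : r1 <= r2 * 0 by rewrite mulr0 leNgt r10.
apply: (cvgr_to_ge (F := \oo) c); apply: nearW => n.
rewrite expr_div_n mulrA ler_pdivlMr ?exprn_gt0//; exact: H.
Qed.

Section ray.
Variable i0 : 'I_d.

Definition ray n : seq V := None :: [seq Some (ord0, nseq k i0) | k <- iota 0 n].

Lemma uniq_ray n : uniq (ray n).
Proof.
rewrite /= map_inj_uniq ?iota_uniq ?andbT; first by apply/mapP => -[].
by move=> k m [/(congr1 size)]; rewrite !size_nseq.
Qed.

Lemma parent_closed_ray n : parent_closed (ray n).
Proof.
move=> v p; rewrite !inE => /orP[/eqP -> //|/mapP[k]].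
rewrite mem_iota/= add0n => kn -> [<-]; case: k kn => [//|k] kn /=.
apply/mapP; exists k; first by rewrite mem_iota/= add0n ltnW.
by rewrite size_nseq -[i0 :: _]/(nseq k.+1 i0) take_nseq ?leqnSn.
Qed.

Definition const_ray n b w : R := (all (fun x => w x == b) (ray n))%:R.

Lemma const_ray_local n b : locally_on [fset x in ray n]%fset (const_ray n b).
Proof.
move=> w1 w2 ww; rewrite /const_ray; congr (nat_of_bool _)%:R.
by apply: eq_in_all => x xr; rewrite ww//=; move: xr; rewrite !inE.
Qed.

(** The constant [c] will be [1] for the all-plus event and [-1] for the all-minus one, whose
    negated indicator is increasing. *)
Lemma integral_const_ray J t n b (c : R) :
  (\int[chain d J t]_w (c * const_ray n b w)%:E)%E =
  (c * (logistic (spin b * (t + phi J t)) * logistic (spin b * t + J) ^+ n))%:E.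
Proof.
have [N HN] := seq_bound (ray n).
have rN : {subset ray n <= seg d N} by move=> x /HN; rewrite mem_seg.
have lf : locally_on [fset x in seg d N]%fset (fun w => c * const_ray n b w).
  move=> w1 w2 ww; congr (_ * _); apply: const_ray_local => x /=.
  rewrite (_ : (x \in [fset y in ray n]%fset) = (x \in ray n)); last by rewrite !inE.
  by move=> /rN xN; apply: ww; rewrite /= inE.
rewrite (integral_chain _ _ lf) expectZ; congr (c * _)%:E.
have mr : [seq x <- seg d N | x \in ray n] =i ray n.
  by move=> x; rewrite mem_filter; case: (boolP (x \in ray n)) => //= /rN.
transitivity (expect (field_kernel J (chain_field J t)) (seg d N)
    (fun w' => (all (fun x => w' x == b) [seq x <- seg d N | x \in ray n])%:R)
    (fun=> false)).
  by congr (expect _ _ _ _); apply/funext => w; rewrite /const_ray (eq_all_r mr).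
rewrite expect_const_spin; [|exact: field_kernel_local|exact: idx_sorted_seg
  |exact: parent_closed_seg|exact: parent_closed_ray].
rewrite -big_filter (perm_big (ray n)); last first.
  apply: uniq_perm mr; rewrite ?uniq_ray// filter_uniq//.
  exact/idx_sorted_uniq/idx_sorted_seg.
have P (x : R) : (if b then logistic x else 1 - logistic x) = logistic (spin b * x).
  by rewrite logisticN /spin; case: (b); rewrite ?mul1r ?mulN1r.
rewrite big_cons big_map; congr (_ * _).
  by rewrite /spin_prob /field_kernel P// /chain_field /pspin/= mulr0 addr0.
rewrite (eq_bigr (fun=> logistic (spin b * t + J))).
  by rewrite big_const_seq count_predT size_iota iter_mulr_1.
move=> k _; rewrite /spin_prob /field_kernel P// /chain_field /pspin/=.
by congr logistic; rewrite mulrDr mulrCA; case: (b); rewrite /spin; ring.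
Qed.

Lemma const_ray_increasing n : increasing (const_ray n true).
Proof.
move=> w1 w2 ww; rewrite ler_nat; case: allP => // H1.
by case: allP => // -[]; move=> x /H1 /eqP e; have := ww x; rewrite e => /eqP.
Qed.

Lemma const_ray_decreasing n : increasing (fun w => -1 * const_ray n false w).
Proof.
move=> w1 w2 ww; rewrite !mulN1r lerN2 ler_nat; case: allP => // H1.
case: allP => // -[]; move=> x /H1 /eqP e; have := ww x; rewrite e.
by case: (w1 x).
Qed.

(** Constant spins on a ray have probabilities decaying at the rates [logistic (t + J)] for [+1] and
    [logistic (- t + J)] for [-1]. Comparing rates gives one inequality for each spin of the
    parent. *)
Lemma chain_dominated_inv J1 J2 t1 t2 :
  dominated (chain d J1 t1) (chain d J2 t2) -> t1 + `|J1 - J2| <= t2.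
Proof.
move=> dom.
have HP : t1 + J1 <= t2 + J2.
  rewrite -ler_logistic.
  apply: (@le_base_of_le_expn (logistic (t1 + phi J1 t1)) (logistic (t2 + phi J2 t2))).
  - exact: logistic_gt0.
  - exact: logistic_gt0.
  - exact/ltW/logistic_gt0.
  move=> n; have L : locally_on [fset x in ray n]%fset (fun w => 1 * const_ray n true w).
    by move=> w1 w2 ww; congr (_ * _); exact: const_ray_local.
  have := dom (fun w => 1 * const_ray n true w).
  rewrite !integral_const_ray /spin !mul1r lee_fin; apply.
    exact: locally_on_continuous L.
  by move=> w1 w2 ww; rewrite !mul1r; exact: const_ray_increasing.
have HM : J2 - t2 <= J1 - t1.
  rewrite -ler_logistic.
  apply: (@le_base_of_le_expn (logistic (- (t2 + phi J2 t2))) (logistic (- (t1 + phi J1 t1)))).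
  - exact: logistic_gt0.
  - exact: logistic_gt0.
  - exact/ltW/logistic_gt0.
  move=> n; have L : locally_on [fset x in ray n]%fset (fun w => -1 * const_ray n false w).
    by move=> w1 w2 ww; congr (_ * _); exact: const_ray_local.
  have := dom (fun w => -1 * const_ray n false w).
  rewrite !integral_const_ray /spin !mulN1r lee_fin lerN2 ![- _ + _]addrC; apply.
    exact: locally_on_continuous L.
  exact: const_ray_decreasing.
have : `|J1 - J2| <= t2 - t1 by rewrite ler_norml; lra.
lra.
Qed.

End ray.

End chain_comparison.

(** * Plus and minus states compared with chains *)

Section states.
Context {R : realType} (d : nat) (d0 : (0 < d)%N).
Implicit Types (J h t : R) (mu nu : probability (config d) R).

(** Mutual domination stands in for equality of measures, as thresholds depend on domination
    only. *)
Definition dom_equiv mu nu := dominated mu nu /\ dominated nu mu.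

(** The chain of [t_plus] is itself a Gibbs measure, so the plus state dominates it; it also
    dominates every Gibbs measure, the plus state included. *)
Lemma plus_state_chain J h mu : 0 <= J -> is_plus_state J h mu ->
  dom_equiv mu (chain d J (t_plus d J h)).
Proof.
move=> J0 [gmu maxmu]; split; first exact: gibbs_le_chain.
by apply/maxmu/chain_gibbs; exact: fp_set_t_plus.
Qed.

Lemma minus_state_chain J h mu : 0 <= J -> is_minus_state J h mu ->
  dom_equiv mu (chain d J (t_minus d J h)).
Proof.
move=> J0 [gmu minmu]; split; last exact: chain_le_gibbs.
by apply/minmu/chain_gibbs; exact: fp_set_t_minus.
Qed.

Lemma dom_equiv_chain J1 J2 t1 t2 mu nu : 0 <= J2 ->
  dom_equiv mu (chain d J1 t1) -> dom_equiv nu (chain d J2 t2) ->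
  dominated mu nu <-> t1 + `|J1 - J2| <= t2.
Proof.
move=> J20 [m1 m2] [n1 n2]; split=> [mn|H].
  apply: (chain_dominated_inv (Ordinal d0)).
  by apply: dominated_trans n1; exact: dominated_trans mn.
apply: dominated_trans n2; apply: dominated_trans m1 _.
exact: chain_dominated.
Qed.

End states.

(* plus J h / minus J h stand for the plus / minus states mu_h^{J,+}, mu_h^{J,-}
   (they exist and are unique; any families with the defining property are
   used).  f_{+/-} = dom_threshold (plus J2) (plus/minus J1 h1),
   g_{+/-} = dom_threshold (minus J2) (plus/minus J1 h1). *)
Theorem theorem1p3 (R : realType) (d : nat) (hd : (2 <= d)%N)
  (plus minus : R -> R -> probability (config d) R)
  (Hplus : forall J h : R, 0 < J -> is_plus_state J h (plus J h))
  (Hminus : forall J h : R, 0 < J -> is_minus_state J h (minus J h))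
  (J1 J2 h1 : R) (hJ1 : 0 < J1) (hJ2 : 0 < J2) :
  let tau_p := t_plus d J1 h1 + `|J1 - J2| in
  let tau_m := t_minus d J1 h1 + `|J1 - J2| in
  (* f_+ and f_- *)
  (forall (mu : probability (config d) R) (tau : R),
     (mu = plus J1 h1 /\ tau = tau_p) \/ (mu = minus J1 h1 /\ tau = tau_m) ->
     ((t_minus d J2 (- h_star d J2) <= tau < t_star d J2) ->
        dom_threshold (plus J2) mu = (- h_star d J2)%:E) /\
     ((t_star d J2 <= tau \/ tau < t_minus d J2 (- h_star d J2)) ->
        dom_threshold (plus J2) mu = (tau - d%:R * phi J2 tau)%:E)) /\
  (* g_+ and g_- *)
  (forall (mu : probability (config d) R) (tau : R),
     (mu = plus J1 h1 /\ tau = tau_p) \/ (mu = minus J1 h1 /\ tau = tau_m) ->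
     ((- t_star d J2 < tau <= t_plus d J2 (h_star d J2)) ->
        dom_threshold (minus J2) mu = (h_star d J2)%:E) /\
     ((tau <= - t_star d J2 \/ t_plus d J2 (h_star d J2) < tau) ->
        dom_threshold (minus J2) mu = (tau - d%:R * phi J2 tau)%:E)).
Proof.
move=> tau_p tau_m.
have J10 := ltW hJ1; have J20 := ltW hJ2.
have d0 : (0 < d)%N by exact: ltn_trans hd.
have domP mu tau h :
    (mu = plus J1 h1 /\ tau = tau_p) \/ (mu = minus J1 h1 /\ tau = tau_m) ->
    (dominated mu (plus J2 h) <-> tau <= t_plus d J2 h) /\
    (dominated mu (minus J2 h) <-> tau <= t_minus d J2 h).
  have pE := plus_state_chain J20 (Hplus J2 h hJ2).
  have mE := minus_state_chain J20 (Hminus J2 h hJ2).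
  case=> -[-> ->].
    have E := plus_state_chain J10 (Hplus J1 h1 hJ1).
    by split; exact: dom_equiv_chain.
  have E := minus_state_chain J10 (Hminus J1 h1 hJ1).
  by split; exact: dom_equiv_chain.
split=> mu tau mt.
  have [H1 H2] := bal_minP d J20 tau.
  by split=> [/H1 M|/H2 M]; apply: (ereal_inf_t_plus J20 M) => h;
    have [] := domP mu tau h mt.
(* For the minus states, the maximum of the odd function [bal] over []-oo, tau]] is minus its
   minimum over [[- tau, +oo[]. *)
have [H1 H2] := bal_minP d J20 (- tau).
split=> [/andP[t1 t2]|t12].
  have M : bal_min d J2 (- tau) (- h_star d J2).
    by apply: H1; rewrite t_minusN opprK lerN2 t2 ltrNl t1.
  by apply: (ereal_inf_t_minus J20 M) => h; have [] := domP mu tau h mt.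
have M : bal_min d J2 (- tau) (- (tau - d%:R * phi J2 tau)).
  rewrite -[- (tau - _)](balN d J2 tau); apply: H2.
  by rewrite t_minusN opprK ltrN2 lerNr.
by apply: (ereal_inf_t_minus J20 M) => h; have [] := domP mu tau h mt.
Qed.
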